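(* For every $\varepsilon>0$ there exists $m_0=m_0(\varepsilon)$ such that for every integer $m\ge m_0$ and every integer $a$ with $\gcd(a,m)=1$ we have $$v_a(m)\le m^{1/2+\varepsilon}.$$ (That is, $v_a(m)\le m^{1/2+o(1)}$ as $m\to\infty$, uniformly over all $a$ coprime to $m$.)
   Context: For integers $a$ and $m\ge 2$, the modular hyperbola is the set of integral points $\mathcal{H}_a(m)=\{(x,y)\in\mathbb{Z}^2 : xy\equiv a \pmod m,\ 1\le x,y\le m-1\}$. Let $\mathcal{C}(a,m)$ be the convex hull (convex closure) of $\mathcal{H}_a(m)$ in $\mathbb{R}^2$, and let $v_a(m)$ denote the number of vertices of the polygon $\mathcal{C}(a,m)$. *)

(* Defs.v *)
From mathcomp Require Import all_boot all_order all_algebra finmap.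
From mathcomp Require Import all_classical all_reals interval_inference.
From mathcomp Require Import convex exp.

Set Implicit Arguments.
Unset Strict Implicit.
Unset Printing Implicit Defensive.

Import Order.TTheory GRing.Theory Num.Theory.

Local Open Scope classical_set_scope.
Local Open Scope ring_scope.

Definition modular_hyperbola (a : int) (m : nat) : set (int * int) :=
  [set p : int * int | [/\ (p.1 * p.2 = a %[mod m])%Z,
                           1 <= p.1 <= m%:Z - 1
                         & 1 <= p.2 <= m%:Z - 1]].

Definition convex_hull (R : realType) (M : lmodType R) (A : set M) : set M :=
  smallest (@convex_set R M) A.

(* The vertices of a convex polygon, including a degenerate one (a segment or
   a point), are its extreme points. *)
Definition extreme_points (R : realType) (M : lmodType R) (K : set M) : set M :=
  [set v | K v /\ forall (x y : M) (t : R), K x -> K y -> 0 < t < 1 ->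
             v = t *: x + (1 - t) *: y -> x = v /\ y = v].

(* The plane is written R^o * R^o because R^o, unlike R, carries the structure
   of a vector space over R. *)
Definition plane_point (R : realType) (p : int * int) : R^o * R^o :=
  (p.1%:~R, p.2%:~R).

Definition hyperbola_hull (R : realType) (a : int) (m : nat) :
    set (R^o * R^o)%type :=
  convex_hull (@plane_point R @` modular_hyperbola a m).

(* fset_set is the empty set on infinite sets; finite_hyperbola_vertices below
   shows that this default value is never used. *)
Definition num_vertices (R : realType) (a : int) (m : nat) : nat :=
  #|` fset_set (extreme_points (@hyperbola_hull R a m)) |%fset.

Lemma extreme_points_hull (R : realType) (M : lmodType R) (A : set M) :
  extreme_points (convex_hull A) `<=` A.
Proof.
move=> v [Kv ext]; apply: contrapT => Av.
have hullA : A `<=` convex_hull A by exact: sub_smallest.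
suff : (convex_hull A `\ v) v by case=> _; exact.
apply: (Kv (convex_hull A `\ v)); split; last first.
  by move=> x Ax; split; [exact: hullA | move=> /= xv; apply: Av; rewrite -xv].
apply/convex_setW => x y; rewrite !inE => -[Kx xv] [Ky yv] k k0 k1; rewrite inE.
split.
  move=> C [cC AC]; apply/set_mem; apply: (cC); apply/mem_set.
  - exact: (Kx C (conj cC AC)).
  - exact: (Ky C (conj cC AC)).
move=> /= E; apply: xv.
by have [|//] := ext x y k%:num Kx Ky _ (esym E); rewrite k0 k1.
Qed.

Lemma finite_modular_hyperbola (a : int) (m : nat) :
  finite_set (modular_hyperbola a m).
Proof.
apply: (@sub_finite_set _ _
  ((fun p : nat * nat => (p.1%:Z, p.2%:Z)) @` (`I_m `*` `I_m))).
  move=> [[x|x] [y|y]] [] _ //= /andP[_ hx] /andP[_ hy].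
  exists (x, y) => //; split => /=.
  - by move: hx; rewrite lerBrDr -PoszD lez_nat addn1.
  - by move: hy; rewrite lerBrDr -PoszD lez_nat addn1.
by apply: finite_image; apply: finite_setX; exact: finite_II.
Qed.

Lemma finite_hyperbola_vertices (R : realType) (a : int) (m : nat) :
  finite_set (extreme_points (@hyperbola_hull R a m)).
Proof.
apply: sub_finite_set (@extreme_points_hull _ _ _) _.
by apply: finite_image; exact: finite_modular_hyperbola.
Qed.

(* Main.v *)
(** For a vertex [v] of the hull, some linear form is minimal at [v] only; up to the reflections
    [x |-> m - x] and [y |-> m - y] it has positive coefficients, so that [v] is the only point of
    the hyperbola in the box [[1, x] * [1, y]] spanned by [v = (x, y)].  The fourth moment of the
    Kloosterman sums (Kloosterman's own bound [m^(3/4)], valid for every modulus) shows that a box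
    of area [m^(7/4+o(1))] contains a point of the hyperbola, whence [x y <= m^(7/4+o(1))].

    Such vertices form a convex chain.  Dyadically in [x ~ X] and [y ~ Y], cut it into [O(Q)] pieces
    on which [x], [y] and the slope of the tangent vary by a proportion [1/Q] only.  For four points
    of a piece, the determinant of the rows [(1, x, y, x y)] is divisible by [m], because
    [x y = a mod m], and it is [O((X Y)^2 / Q^5)]; hence it vanishes as soon as
    [Q^5 >> (X Y)^2 / m], which holds for some [Q = m^(1/2+o(1))].  The points of a piece then lie
    on a hyperbola [(A s + c) (A t + b) = b c] with integer coefficients, and there are at most
    [m^o(1)] of them by the divisor bound. *)

Require Import Defs.
From mathcomp Require Import all_boot all_order all_algebra all_solvable all_field finmap.
From mathcomp Require Import zify ring lra.
From mathcomp Require Import all_classical all_reals interval_inference convex exp.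

Set Implicit Arguments.
Unset Strict Implicit.
Unset Printing Implicit Defensive.

Import Order.TTheory GRing.Theory Num.Theory.

(** * The divisor bound *)

Definition tau (n : nat) : nat := size (divisors n).

Lemma tau_gt0 n : 0 < n -> 0 < tau n.
Proof. by move=> n0; rewrite /tau -has_predT; apply/hasP; exists n; rewrite ?divisors_id. Qed.

(** A divisor [d] of [a * b] is recovered from the pair [gcdn d a], [d %/ gcdn d a]; the second
    entry divides [b] because it is coprime to [a %/ gcdn d a]. *)
Lemma tauM a b : 0 < a -> 0 < b -> tau (a * b) <= tau a * tau b.
Proof.
move=> a0 b0.
pose s := [seq x * y | x <- divisors a, y <- divisors b].
have -> : tau a * tau b = size s by rewrite size_allpairs.
apply: uniq_leq_size (divisors_uniq _) _ => d.
rewrite -dvdn_divisors ?muln_gt0 ?a0 // => dab.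
apply/allpairsP; exists (gcdn d a, d %/ gcdn d a) => /=.
have g0 : 0 < gcdn d a by rewrite gcdn_gt0 a0 orbT.
rewrite -!dvdn_divisors // dvdn_gcdr mulnC divnK ?dvdn_gcdl //; split=> //.
have co : coprime (d %/ gcdn d a) (a %/ gcdn d a).
  rewrite /coprime -(eqn_pmul2l g0) muln1 muln_gcdr.
  by rewrite ![gcdn d a * _]mulnC !divnK ?dvdn_gcdl ?dvdn_gcdr.
rewrite -(Gauss_dvdr _ co) -(dvdn_pmul2l g0) mulnA.
by rewrite ![gcdn d a * _]mulnC !divnK ?dvdn_gcdl ?dvdn_gcdr.
Qed.

Lemma tau_pfactor p e : prime p -> tau (p ^ e) <= e.+1.
Proof.
move=> pp; rewrite -[e.+1](size_iota 0) -(size_map (expn p)).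
apply: uniq_leq_size (divisors_uniq _) _ => d.
rewrite -dvdn_divisors ?expn_gt0 ?prime_gt0 // => /(dvdn_pfactor _ _ pp) [k ke ->].
by apply: map_f; rewrite mem_iota /= add0n ltnS.
Qed.

Lemma leq_expn2r k a b : a <= b -> a ^ k <= b ^ k.
Proof. by case: k => // k; rewrite leq_exp2r. Qed.

(** With $q = \lfloor e/k \rfloor$ one has $e + 1 \le k (q + 1) \le k 2^q$; then take $k$-th
    powers. *)
Lemma succ_exp_le k e : e.+1 ^ k <= k ^ k * 2 ^ e.
Proof.
case: k => [|k]; first by rewrite !expn0 mul1n expn_gt0.
have le1 : e.+1 <= k.+1 * 2 ^ (e %/ k.+1).
  apply: leq_trans (_ : k.+1 * (e %/ k.+1).+1 <= _).
    by rewrite mulnC; apply: ltn_ceil.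
  by rewrite leq_mul2l ltn_expl ?orbT.
apply: leq_trans (leq_expn2r _ le1) _.
rewrite expnMn leq_mul2l -expnM leq_pexp2l ?orbT //.
exact: leq_trunc_div.
Qed.

Lemma self_exp_gt0 k : 0 < k ^ k.
Proof. by case: k => // k; rewrite expn_gt0. Qed.

(** Only the primes below $2^k$ cost a factor $k^k$: if $p \ge 2^k$, then $(e+1)^k \le 2^{ek} \le
    p^e$. *)
Lemma tau_prod_pfactor k (s : seq nat) (f : nat -> nat) : all prime s ->
  tau (\prod_(p <- s) p ^ f p) ^ k
    <= (k ^ k) ^ count (fun p => p < 2 ^ k) s * \prod_(p <- s) p ^ f p.
Proof.
elim: s => [|p s IH] /=; first by rewrite big_nil (_ : tau 1 = 1) ?exp1n.
case/andP=> pp ps; rewrite big_cons.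
have p0 : 0 < p ^ f p by rewrite expn_gt0 prime_gt0.
have s0 : 0 < \prod_(p <- s) p ^ f p.
  rewrite big_seq; apply: prodn_cond_gt0 => q qs.
  by rewrite expn_gt0 prime_gt0 // (allP ps).
apply: leq_trans (leq_expn2r k (tauM p0 s0)) _.
rewrite expnMn expnD mulnACA; apply: leq_mul (IH ps).
apply: leq_trans (leq_expn2r k (tau_pfactor (f p) pp)) _.
case: ltnP => plt /=.
  rewrite expn1; apply: leq_trans (succ_exp_le k (f p)) _.
  by rewrite leq_mul2l leq_expn2r ?orbT // prime_gt1.
rewrite expn0 mul1n; apply: leq_trans (leq_expn2r (f p) plt).
by rewrite -expnM mulnC expnM leq_expn2r // ltn_expl.
Qed.

(** This is $\tau(n) = n^{o(1)}$ with [k] in the role of $1/\varepsilon$. The constant comes from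
    the primes below $2^k$, of which there are at most $2^k$. *)
Theorem divisor_bound k : exists2 C, 0 < C & forall n, 0 < n -> tau n ^ k <= C * n.
Proof.
exists ((k ^ k) ^ 2 ^ k) => [|n n0]; first by rewrite expn_gt0 self_exp_gt0.
have En : n = \prod_(p <- primes n) p ^ logn p n.
  by rewrite {1}(prod_prime_decomp n0) prime_decompE big_map.
have pr : all prime (primes n) by apply/allP => p; rewrite mem_primes => /andP[].
have := tau_prod_pfactor k (logn^~ n) pr; rewrite -En => /leq_trans; apply.
rewrite leq_mul2r leq_pexp2l ?orbT ?self_exp_gt0 //.
rewrite -size_filter -[leqRHS](size_iota 0).
apply: uniq_leq_size; first exact/filter_uniq/primes_uniq.
by move=> p; rewrite mem_filter mem_iota => /andP[].
Qed.

Lemma leq_totient_dvd d n : 0 < n -> d %| n -> totient d <= totient n.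
Proof.
move=> n0 dn; have d0 : 0 < d by apply: dvdn_gt0 dn.
rewrite !totientE //.
have eqp : perm_eq (primes d) [seq p <- primes n | p \in primes d].
  apply: uniq_perm; rewrite ?filter_uniq ?primes_uniq // => p.
  rewrite mem_filter; case pd : (p \in _) => //=; apply/esym.
  move: pd; rewrite !mem_primes => /and3P[-> _ pd].
  by rewrite n0 (dvdn_trans pd dn).
rewrite (perm_big _ eqp) big_filter big_mkcond /= big_seq [leqRHS]big_seq.
apply: leq_prod => p; rewrite mem_primes => /and3P[pp _ _].
case: ifP => _.
  rewrite leq_mul2l leq_pexp2l ?orbT ?prime_gt0 //.
  by rewrite -!subn1 leq_sub2r // dvdn_leq_log.
have p1 := prime_gt1 pp; rewrite muln_gt0 expn_gt0; lia.
Qed.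

(** In $n = \sum_{d \mid n} \varphi(d)$ no term exceeds $\varphi(n)$. *)
Lemma leq_tau_totient n : 0 < n -> n <= tau n * totient n.
Proof.
move=> n0; rewrite -[leqLHS]sum_totient_dvd.
rewrite -(big_mkord (fun d => d %| n) totient) -big_filter.
apply: (@leq_trans (\sum_(d <- [seq d <- index_iota 0 n.+1 | d %| n]) totient n)).
  rewrite big_seq [leqRHS]big_seq; apply: leq_sum => d.
  by rewrite mem_filter => /andP[dn _]; apply: leq_totient_dvd.
rewrite big_const_seq iter_addn_0 mulnC leq_mul2r; apply/orP; right.
rewrite count_predT; apply: uniq_leq_size => [|d].
  exact/filter_uniq/iota_uniq.
by rewrite mem_filter -dvdn_divisors // => /andP[].
Qed.

Local Open Scope ring_scope.

(** * Kloosterman sums *)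

Lemma sum_nat_dvd_ord (n d : nat) : (0 < n -> d %| n -> \sum_(z < n) (d %| z) <= n %/ d)%N.
Proof.
move=> n0 /dvdnP[q En]; have d0 : (0 < d)%N by case: d En n0 => //; lia.
rewrite En mulnK // -En -big_mkcond sum1dep_card.
case: n n0 En => // n _ En.
pose f (k : 'I_q) : 'I_n.+1 := inord (k * d).
rewrite -[leqRHS](card_ord q); apply: leq_trans (leq_imset_card f predT).
apply/subset_leq_card/fintype.subsetP => z; rewrite inE => /dvdnP[k Ek].
have kq : (k < q)%N by rewrite -(ltn_pmul2r d0) -Ek -En.
by apply/imsetP; exists (Ordinal kq) => //; apply/val_inj; rewrite /= inordK -Ek.
Qed.

Lemma Zp_mul_eq0 (n : nat) (x z : 'I_n.+2) : (x * z == 0) = (n.+2 %| x * z)%N.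
Proof. by rewrite -val_eqE. Qed.

Lemma Zp_natr_val (n k : nat) : (k%:R : 'I_n.+2) = (k %% n.+2)%N :> nat.
Proof. exact: (@val_Zp_nat n.+2). Qed.

Lemma sum_annihilator (n : nat) (x : 'I_n.+2) :
  (\sum_(z : 'I_n.+2) (x * z == 0)%R <= gcdn x n.+2)%N.
Proof.
set g := gcdn x n.+2; have g0 : (0 < g)%N by rewrite gcdn_gt0 orbT.
have gm : (g %| n.+2)%N by apply: dvdn_gcdr.
have gx : (g %| x)%N by apply: dvdn_gcdl.
apply: (@leq_trans (\sum_(z < n.+2) (n.+2 %/ g %| z))%N); last first.
  apply: leq_trans (sum_nat_dvd_ord _ _) _ => //; first exact: dvdn_div.
  by rewrite divnA // mulKn.
apply: leq_sum => z _; rewrite Zp_mul_eq0.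
rewrite -{1}(divnK gm) -{1}(divnK gx) mulnAC dvdn_pmul2r // Gauss_dvdr //.
rewrite coprime_sym /coprime -(eqn_pmul2r g0) mul1n muln_gcdl !divnK //.
Qed.

Lemma sum_annihilator_coset (n : nat) (x c : 'I_n.+2) :
  (\sum_(z : 'I_n.+2) (x * (z - c) == 0)%R <= gcdn x n.+2)%N.
Proof.
apply: leq_trans (sum_annihilator x).
by rewrite (reindex_inj (addIr c)) /=; apply: leq_sum => z _; rewrite addrK.
Qed.

Lemma gcdn_ZpM (n : nat) (x y : 'I_n.+2) :
  (gcdn (x * y)%R n.+2 <= gcdn x n.+2 * gcdn y n.+2)%N.
Proof.
rewrite gcdn_modl dvdn_leq ?muln_gt0 ?gcdn_gt0 ?orbT //.
rewrite muln_gcdr !muln_gcdl !dvdn_gcd.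
rewrite dvdn_gcdl ?(dvdn_mull _ (dvdn_gcdr _ _)) ?(dvdn_mulr _ (dvdn_gcdr _ _)) //.
Qed.

Lemma sum_gcdn (n : nat) : (0 < n -> \sum_(z < n) gcdn z n <= n * tau n)%N.
Proof.
move=> n0; apply: (@leq_trans (\sum_(z < n) \sum_(d <- divisors n) d * (d %| z))%N).
  apply: leq_sum => z _.
  rewrite (big_rem (gcdn z n)) /= -?dvdn_divisors ?dvdn_gcdr //.
  by rewrite dvdn_gcdl muln1 leq_addr.
rewrite exchange_big /= [leqRHS]mulnC.
rewrite /tau -sum1_size big_distrl /= big_seq [leqRHS]big_seq; apply: leq_sum => d.
rewrite -dvdn_divisors // => dn; rewrite mul1n -big_distrr /=.
by apply: leq_trans (leq_mul (leqnn d) (sum_nat_dvd_ord n0 dn)) _; rewrite mulnC leq_trunc_div.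
Qed.

(** The difference of two solutions [c] is annihilated by [2 x], and doubling [x] at most doubles
    its gcd with the modulus. *)
Lemma sum_annihilator_double (n : nat) (x s : 'I_n.+2) :
  (\sum_(c : 'I_n.+2) (x * (c + c - s) == 0)%R <= 2 * gcdn x n.+2)%N.
Proof.
have [c0|] := pickP (fun c => x * (c + c - s) == 0)%R; last first.
  by move=> none; rewrite big1 // => c _; rewrite none.
move=> /eqP Ec0; apply: leq_trans (_ : gcdn (2%:R * x)%R n.+2 <= _)%N; last first.
  apply: leq_trans (gcdn_ZpM _ _) _; rewrite leq_mul2r; apply/orP; right.
  by rewrite Zp_natr_val gcdn_modl dvdn_leq ?dvdn_gcdl.
apply: leq_trans (sum_annihilator_coset _ c0); apply: leq_sum => c _.
apply: (@leq_trans (nat_of_bool (2%:R * x * (c - c0) == 0)%R)) => //.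
case E: (x * (c + c - s) == 0) => //; move/eqP: E => E.
suff -> : 2%:R * x * (c - c0) = 0 by rewrite eqxx.
by transitivity (x * (c + c - s) - x * (c0 + c0 - s)); [ring | rewrite E Ec0 subr0].
Qed.

(** In the variables $A = u_3 - u_1$, $B = u_3 - u_2$ the equation reads $g (2 u_3 - A - B) A B =
    0$. For fixed $A$, $B$ it has at most $2 g \gcd(A, m) \gcd(B, m)$ solutions $u_3$, and the two
    gcds are summed separately. *)
Lemma energy_count (n g : nat) : (g %| n.+2)%N ->
  (\sum_(u1 : 'I_n.+2) \sum_(u2 : 'I_n.+2) \sum_(u3 : 'I_n.+2)
     (g%:R * (u1 + u2) * (u3 - u1) * (u3 - u2) == 0)%R
   <= 2 * g * (n.+2 * tau n.+2) ^ 2)%N.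
Proof.
move=> gm.
have Eg : gcdn (g%:R : 'I_n.+2) n.+2 = g.
  by rewrite Zp_natr_val gcdn_modl; apply/gcdn_idPl.
under eq_bigr => u1 _ do rewrite exchange_big /=.
rewrite exchange_big /=.
under eq_bigr => u3 _.
  rewrite (reindex_inj (inv_inj (subKr u3))) /=.
  under eq_bigr => A _ do rewrite (reindex_inj (inv_inj (subKr u3))) /=.
  over.
rewrite exchange_big /=; under eq_bigr => A _ do rewrite exchange_big /=.
apply: (@leq_trans (\sum_(A < n.+2) \sum_(B < n.+2) 2 * g * (gcdn A n.+2 * gcdn B n.+2))%N).
  apply: leq_sum => A _; apply: leq_sum => B _.
  apply: (@leq_trans (2 * gcdn (g%:R * A * B)%R n.+2)%N); last first.
    rewrite -mulnA leq_mul2l; apply/orP; right; apply: leq_trans (gcdn_ZpM _ _) _.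
    rewrite mulnA leq_mul2r; apply/orP; right.
    by apply: leq_trans (gcdn_ZpM _ _) _; rewrite Eg.
  apply: leq_trans (sum_annihilator_double _ (A + B)); apply: leq_sum => c _.
  rewrite !subKr (_ : g%:R * (c - A + (c - B)) * A * B = g%:R * A * B * (c + c - (A + B))) //.
  by ring.
under eq_bigr => A _ do rewrite -big_distrr /= -big_distrr /=.
rewrite -big_distrr /= -big_distrl /= leq_mul2l; apply/orP; right.
by apply: leq_mul; apply: sum_gcdn.
Qed.

(** * Additive characters modulo m *)

Definition Zp_char (n : nat) (w : algC) (x : 'I_n.+2) : algC := w ^+ x.

Lemma Zp_char0 (n : nat) (w : algC) : Zp_char w (0 : 'I_n.+2) = 1.
Proof. by rewrite /Zp_char expr0. Qed.

Lemma Zp_charD (n : nat) (w : algC) (x y : 'I_n.+2) : n.+2.-primitive_root w ->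
  Zp_char w (x + y) = Zp_char w x * Zp_char w y.
Proof. by move=> pw; rewrite /Zp_char /= (prim_expr_mod pw) exprD. Qed.

Lemma norm_Zp_char (n : nat) (w : algC) (x : 'I_n.+2) : n.+2.-primitive_root w ->
  `|Zp_char w x| = 1.
Proof.
move=> pw; rewrite normrX (_ : `|w| = 1) ?expr1n //.
by apply/eqP; rewrite -(@pexpr_eq1 _ _ n.+2) // -normrX prim_expr_order // normr1.
Qed.

Lemma conj_Zp_char (n : nat) (w : algC) (x : 'I_n.+2) : n.+2.-primitive_root w ->
  (Zp_char w x)^* = Zp_char w (- x).
Proof.
move=> pw; have nz : Zp_char w x != 0 by rewrite -normr_eq0 norm_Zp_char ?oner_eq0.
apply: (mulfI nz); rewrite -normCK norm_Zp_char // expr1n -Zp_charD // subrr Zp_char0 //.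
Qed.

Lemma Zp_char_eq1 (n : nat) (w : algC) (x : 'I_n.+2) : n.+2.-primitive_root w ->
  (Zp_char w x == 1) = (x == 0).
Proof.
move=> pw; rewrite /Zp_char -(prim_order_dvd pw) -val_eqE /=.
by case: x => [[|x] lx] //=; rewrite ?dvdn0 // gtnNdvd.
Qed.

Lemma Zp_dvdD (n g : nat) (x y : 'I_n.+2) : (g %| n.+2)%N -> (g %| x)%N ->
  (g %| (x + y)%R)%N = (g %| y)%N.
Proof. by move=> gm gx; rewrite /= /dvdn modn_dvdm // -/(dvdn _ _) dvdn_addr. Qed.

Lemma Zp_dvdM (n g : nat) (x y : 'I_n.+2) : (g %| n.+2)%N -> (g %| x)%N -> (g %| (x * y)%R)%N.
Proof. by move=> gm gx; rewrite /= /dvdn modn_dvdm // -/(dvdn _ _) dvdn_mulr. Qed.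

Lemma Zp_dvd_natr (n g : nat) : (g %| n.+2)%N -> (g %| (g%:R : 'I_n.+2))%N.
Proof. by move=> gm; rewrite Zp_natr_val /dvdn modn_dvdm // modnn. Qed.

(** Translating [h] by [g] permutes the range of summation and multiplies the sum by the character
    at [g * z], which differs from 1. *)
Lemma sum_Zp_char_eq0 (n g : nat) (w : algC) (z : 'I_n.+2) : n.+2.-primitive_root w ->
  (g %| n.+2)%N -> g%:R * z != 0 -> \sum_(h < n.+2 | (g %| h)%N) Zp_char w (h * z) = 0.
Proof.
move=> pw gm gz; apply/eqP; set S := \sum_(h < _ | _) _.
suff : (Zp_char w (g%:R * z) - 1) * S == 0 by rewrite mulf_eq0 subr_eq0 Zp_char_eq1 // (negPf gz).
rewrite mulrBl mul1r subr_eq0 {2}/S (reindex_inj (addrI (g%:R : 'I_n.+2))) /= mulr_sumr.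
apply/eqP/eq_big => [h|h _]; first by rewrite (@Zp_dvdD _ g) // Zp_dvd_natr.
by rewrite mulrDl Zp_charD.
Qed.

(** Orthogonality on the subgroup of multiples of [g]. The lower bound also says that the sum is
    real, which is needed to multiply two such estimates in [algC]. *)
Lemma sum_Zp_char_le (n g : nat) (w : algC) (z : 'I_n.+2) : n.+2.-primitive_root w ->
  (g %| n.+2)%N ->
  0 <= \sum_(h < n.+2 | (g %| h)%N) Zp_char w (h * z) <= (n.+2 %/ g * (g%:R * z == 0)%R)%N%:R.
Proof.
move=> pw gm; have [gz|gz] := boolP (g%:R * z == 0); last by rewrite sum_Zp_char_eq0 //= muln0 lexx.
move/eqP: gz => gz.
rewrite (eq_bigr (fun _ => 1)) => [|h /dvdnP[k Ek]].
  rewrite /= sumr_const ler0n ler_nat muln1 -sum1_card.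
  by apply: leq_trans (sum_nat_dvd_ord _ gm); rewrite // big_mkcond /=.
apply/eqP; rewrite Zp_char_eq1 // (_ : h = k%:R * g%:R); first by rewrite -mulrA gz mulr0.
by rewrite -natrM -Ek; apply/val_inj; rewrite /= Zp_natr_val modn_small.
Qed.

(** The Fourier coefficient at the frequency [(h, k)] of the hyperbola, parametrized by its points
    [(u, a / u)]. *)
Definition kloosterman (n : nat) (w : algC) (a h k : 'I_n.+2) : algC :=
  \sum_(u | u \is a GRing.unit) Zp_char w (h * u + k * (a / u)).

Lemma kloosterman_scale (n : nat) (w : algC) (a h k t : 'I_n.+2) : t \is a GRing.unit ->
  kloosterman w a (t * h) (k / t) = kloosterman w a h k.
Proof.
move=> ut; rewrite {2}/kloosterman (reindex_inj (mulrI ut)) /=.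
apply: eq_big => [u|u uu]; first by rewrite unitrM ut.
by rewrite invrM // -!mulrA; congr (Zp_char _ (_ + _)); ring.
Qed.

Lemma kloosterman_pow4 (n : nat) (w : algC) (a h k : 'I_n.+2) : n.+2.-primitive_root w ->
  `|kloosterman w a h k| ^+ 4 =
  \sum_(u1 | u1 \is a GRing.unit) \sum_(u2 | u2 \is a GRing.unit)
  \sum_(u3 | u3 \is a GRing.unit) \sum_(u4 | u4 \is a GRing.unit)
    Zp_char w (h * (u1 + u2 - u3 - u4)) * Zp_char w (k * (a / u1 + a / u2 - a / u3 - a / u4)).
Proof.
move=> pw; set K := kloosterman _ _ _ _.
have EC : K^* = \sum_(u : 'I_n.+2 | u \is a GRing.unit) Zp_char w (- (h * u + k * (a / u))).
  by rewrite rmorph_sum /=; apply: eq_bigr => u _; rewrite conj_Zp_char.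
have -> : `|K| ^+ 4 = K * (K * (K^* * K^* )).
  by rewrite -[4%N]/(2 * 2)%N exprM normCK; ring.
have EK : K = \sum_(u : 'I_n.+2 | u \is a GRing.unit) Zp_char w (h * u + k * (a / u)) by [].
rewrite {1}EK mulr_suml; apply: eq_bigr => u1 _.
rewrite {1}EK mulr_suml mulr_sumr; apply: eq_bigr => u2 _.
rewrite EC mulr_suml !mulr_sumr; apply: eq_bigr => u3 _.
rewrite !mulr_sumr; apply: eq_bigr => u4 _.
by rewrite -!Zp_charD //; congr (Zp_char _ _); ring.
Qed.

(** Clearing denominators in the second equation and eliminating $u_4$ by the first leaves a
    polynomial that factors as $-(u_1 + u_2)(u_3 - u_1)(u_3 - u_2)$, times $g$. *)
Lemma kloosterman_energy (n g : nat) (a u1 u2 u3 u4 : 'I_n.+2) :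
  a \is a GRing.unit -> u1 \is a GRing.unit -> u2 \is a GRing.unit ->
  u3 \is a GRing.unit -> u4 \is a GRing.unit ->
  g%:R * (u1 + u2 - u3 - u4) = 0 -> g%:R * (a / u1 + a / u2 - a / u3 - a / u4) = 0 ->
  g%:R * (u1 + u2) * (u3 - u1) * (u3 - u2) = 0.
Proof.
move=> ua U1 U2 U3 U4 Es Er.
have E4 : g%:R * u4 = g%:R * (u1 + u2 - u3).
  by apply/eqP; rewrite eq_sym -subr_eq0 -mulrBr Es.
have : g%:R * (a / u1 + a / u2 - a / u3 - a / u4) * (a^-1 * u1 * u2 * u3 * u4) = 0.
  by rewrite Er mul0r.
have -> : g%:R * (a / u1 + a / u2 - a / u3 - a / u4) * (a^-1 * u1 * u2 * u3 * u4)
   = (a / a) * g%:R * ((u1 / u1) * u2 * u3 * u4 + (u2 / u2) * u1 * u3 * u4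
       - (u3 / u3) * u1 * u2 * u4 - (u4 / u4) * u1 * u2 * u3) by ring.
rewrite !divrr // !mul1r => E.
have E' : (g%:R * u4) * (u2 * u3 + u1 * u3 - u1 * u2) - g%:R * u1 * u2 * u3 = 0.
  by rewrite -E; ring.
by rewrite E4 in E'; rewrite -[RHS]oppr0 -E'; ring.
Qed.

(** By orthogonality the moment is at most $(m/g)^2$ times the number of quadruples solving both
    equations of [kloosterman_energy]. There are at most $2 g (m \tau(m))^2$ triples $(u_1, u_2,
    u_3)$, and each leaves at most $g$ values of $u_4$. *)
Lemma sum_kloosterman_pow4 (n g : nat) (w : algC) (a : 'I_n.+2) : n.+2.-primitive_root w ->
  a \is a GRing.unit -> (g %| n.+2)%N ->
  \sum_(h < n.+2 | (g %| h)%N) \sum_(k < n.+2 | (g %| k)%N) `|kloosterman w a h k| ^+ 4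
   <= (2 * n.+2 ^ 4 * tau n.+2 ^ 2)%:R.
Proof.
move=> pw ua gm; set M := (n.+2 %/ g)%N.
have Eg : gcdn (g%:R : 'I_n.+2) n.+2 = g.
  by rewrite Zp_natr_val gcdn_modl; apply/gcdn_idPl.
pose Q (u1 u2 u3 u4 : 'I_n.+2) : nat :=
  ((g%:R * (u1 + u2) * (u3 - u1) * (u3 - u2) == 0)%R * (g%:R * (u4 - (u1 + u2 - u3)) == 0)%R)%N.
apply: (@le_trans _ _ (\sum_(u1 : 'I_n.+2) \sum_(u2 : 'I_n.+2) \sum_(u3 : 'I_n.+2)
   \sum_(u4 : 'I_n.+2) M ^ 2 * Q u1 u2 u3 u4)%N%:R).
  under eq_bigr => h _ do under eq_bigr => k _ do rewrite kloosterman_pow4 //.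
  under eq_bigr => h _ do rewrite exchange_big /=.
  rewrite exchange_big /= big_mkcond natr_sum /=; apply: ler_sum => u1 _; case: ifP => // U1.
  under eq_bigr => h _ do rewrite exchange_big /=.
  rewrite exchange_big /= big_mkcond natr_sum /=; apply: ler_sum => u2 _; case: ifP => // U2.
  under eq_bigr => h _ do rewrite exchange_big /=.
  rewrite exchange_big /= big_mkcond natr_sum /=; apply: ler_sum => u3 _; case: ifP => // U3.
  under eq_bigr => h _ do rewrite exchange_big /=.
  rewrite exchange_big /= big_mkcond natr_sum /=; apply: ler_sum => u4 _; case: ifP => U4 //.
  under eq_bigr => h _ do rewrite -mulr_sumr.
  rewrite -mulr_suml.
  have /andP[s0 s1] := sum_Zp_char_le (u1 + u2 - u3 - u4) pw gm.
  have /andP[r0 r1] := sum_Zp_char_le (a / u1 + a / u2 - a / u3 - a / u4) pw gm.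
  apply: le_trans (ler_pM s0 r0 s1 r1) _; rewrite -natrM ler_nat -/M mulnACA mulnn.
  rewrite leq_mul2l; apply/orP; right; rewrite /Q.
  case: eqP => // Es; case: eqP => // Er.
  rewrite (kloosterman_energy ua U1 U2 U3 U4 Es Er) eqxx.
  rewrite (_ : g%:R * (u4 - (u1 + u2 - u3)) = - (g%:R * (u1 + u2 - u3 - u4))); last by ring.
  by rewrite Es oppr0 eqxx.
rewrite ler_nat.
apply: (@leq_trans (\sum_(u1 : 'I_n.+2) \sum_(u2 : 'I_n.+2) \sum_(u3 : 'I_n.+2)
   M ^ 2 * g * (g%:R * (u1 + u2) * (u3 - u1) * (u3 - u2) == 0)%R)%N).
  do 3!apply: leq_sum => ? _; rewrite -big_distrr /= /Q -big_distrr /= -mulnA leq_mul2l.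
  apply/orP; right; rewrite [leqRHS]mulnC leq_mul2l; apply/orP; right.
  by rewrite -[leqRHS]Eg; apply: sum_annihilator_coset.
under eq_bigr => u1 _ do under eq_bigr => u2 _ do rewrite -big_distrr /=.
under eq_bigr => u1 _ do rewrite -big_distrr /=.
rewrite -big_distrr /=; apply: leq_trans (leq_mul (leqnn _) (energy_count gm)) _.
rewrite (_ : M ^ 2 * g * (2 * g * (n.+2 * tau n.+2) ^ 2) =
             2 * (M * g) ^ 2 * n.+2 ^ 2 * tau n.+2 ^ 2)%N; last by ring.
by rewrite /M divnK // -[(2 * _ * _)%N]mulnA -expnD.
Qed.

Lemma sum_unit_Zp (n : nat) : (\sum_(t : 'I_n.+2 | t \is a GRing.unit) 1 = totient n.+2)%N.
Proof.
by rewrite totient_count_coprime big_mkord big_mkcond.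
Qed.

(* [|K(h, k)|] is constant on the orbit of [(h, k)] under [(t h, k / t)], which consists of
   multiples of [g] and on which each value is taken by at most [g] units [t]. *)
Lemma kloosterman_orbit (n : nat) (w : algC) (a h k : 'I_n.+2) (g := gcdn (gcdn h k) n.+2) :
  (totient n.+2)%:R * `|kloosterman w a h k| ^+ 4 <=
  g%:R * \sum_(h' < n.+2 | (g %| h')%N) \sum_(k' < n.+2 | (g %| k')%N)
            `|kloosterman w a h' k'| ^+ 4.
Proof.
have gm : (g %| n.+2)%N by apply: dvdn_gcdr.
have gh : (g %| h)%N by apply: dvdn_trans (dvdn_gcdl _ _) (dvdn_gcdl _ _).
have gk : (g %| k)%N by apply: dvdn_trans (dvdn_gcdl _ _) (dvdn_gcdr _ _).
have Eg : gcdn (g%:R : 'I_n.+2) n.+2 = g.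
  by rewrite Zp_natr_val gcdn_modl; apply/gcdn_idPl.
rewrite -sum_unit_Zp natr_sum mulr_suml.
pose N (h' k' t : 'I_n.+2) : nat := (t \is a GRing.unit) && (t * h == h') && (k / t == k').
apply: (@le_trans _ _ (\sum_(t : 'I_n.+2) \sum_(h' < n.+2 | (g %| h')%N)
   \sum_(k' < n.+2 | (g %| k')%N) (N h' k' t)%:R * `|kloosterman w a h' k'| ^+ 4)).
  rewrite big_mkcond /=; apply: ler_sum => t _.
  have nn h' : 0 <= \sum_(k' < n.+2 | (g %| k')%N) (N h' k' t)%:R * `|kloosterman w a h' k'| ^+ 4.
    by apply: sumr_ge0 => k' _; rewrite mulr_ge0 ?exprn_ge0.
  case: ifP => ut; last by apply: sumr_ge0.
  rewrite (bigD1 (t * h)); last by rewrite mulrC Zp_dvdM.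
  apply: ler_wpDr; first by apply: sumr_ge0.
  rewrite (bigD1 (k / t)); last exact: Zp_dvdM.
  apply: ler_wpDr; first by apply: sumr_ge0 => k' _; rewrite mulr_ge0 ?exprn_ge0.
  by rewrite /N ut !eqxx kloosterman_scale.
rewrite exchange_big mulr_sumr /=; apply: ler_sum => h' _.
rewrite exchange_big mulr_sumr /=; apply: ler_sum => k' _.
rewrite -mulr_suml ler_wpM2r ?exprn_ge0 // -natr_sum ler_nat.
have [t0|none] :=
  pickP (fun t => (t \is a GRing.unit) && (t * h == h') && (k / t == k')); last first.
  by rewrite big1 // => t _; rewrite /N none.
case/andP => /andP[ut0 /eqP Eh] /eqP Ek.
rewrite -[leqRHS]Eg; apply: leq_trans (sum_annihilator_coset _ t0); apply: leq_sum => t _.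
rewrite /N; case: (boolP (_ && _)) => // /andP[/andP[ut /eqP Eh'] /eqP Ek'].
rewrite lt0b.
(* If [t] and [t0] give the same pair, then [t - t0] annihilates both [h] and [k], hence also their
   gcd with the modulus, [g]; at most [g] residues do. *)
have e1 : (t - t0) * h = 0 by rewrite mulrBl Eh Eh' subrr.
have e2 : (t - t0) * k = 0.
  have : k / t * (t * t0) = k / t0 * (t * t0) by rewrite Ek Ek'.
  have -> : k / t * (t * t0) = (t / t) * t0 * k by ring.
  have -> : k / t0 * (t * t0) = (t0 / t0) * t * k by ring.
  by rewrite !divrr // !mul1r mulrBl => ->; rewrite subrr.
rewrite Zp_mul_eq0.
move/eqP: e1; move/eqP: e2; rewrite !Zp_mul_eq0 => d2 d1.
rewrite mulnC Zp_natr_val.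
rewrite /dvdn modnMmr -/(dvdn _ _) /g !muln_gcdr !dvdn_gcd d1 d2 dvdn_mull //.
Qed.

(** A single orbit is bounded by the whole fourth moment over the multiples of [g];
    [leq_tau_totient] then trades $\varphi(m)$ for $m / \tau(m)$. *)
Theorem kloosterman_bound (n : nat) (w : algC) (a h k : 'I_n.+2) : n.+2.-primitive_root w ->
  a \is a GRing.unit ->
  `|kloosterman w a h k| ^+ 4 <= (2 * n.+2 ^ 3 * tau n.+2 ^ 3 * gcdn (gcdn h k) n.+2)%:R.
Proof.
move=> pw ua; set g := gcdn _ _; have gm : (g %| n.+2)%N by apply: dvdn_gcdr.
have n0 : (0 < n.+2)%N by [].
have b1 := kloosterman_orbit w a h k; rewrite -/g in b1.
have b2 := sum_kloosterman_pow4 pw ua gm.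
have b3 := le_trans b1 (ler_wpM2l (ler0n _ g) b2).
have t0 : 0 < (n.+2)%:R :> algC by rewrite ltr0n.
rewrite -(ler_pM2l t0).
apply: (@le_trans _ _ ((tau n.+2)%:R * ((totient n.+2)%:R * `|kloosterman w a h k| ^+ 4))).
  rewrite mulrA ler_wpM2r ?exprn_ge0 // -natrM ler_nat; exact: leq_tau_totient.
apply: le_trans (ler_wpM2l (ler0n _ _) b3) _; rewrite -!natrM ler_nat.
by apply/eq_leq; ring.
Qed.

(** * Points of the hyperbola in a box *)

Lemma sum_nat_modn_eq (X M x : nat) : (0 < M)%N ->
  (\sum_(y < X) (x == y %[mod M]) <= (X %/ M).+1)%N.
Proof.
move=> M0; rewrite -big_mkcond sum1dep_card.
rewrite -[leqRHS]card_ord.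
apply: (@leq_card_in _ _ (fun y : 'I_X => inord (y %/ M))) => y y'.
rewrite !inE => /eqP E /eqP E' /(congr1 val).
have lt (z : 'I_X) : (z %/ M < (X %/ M).+1)%N by rewrite ltnS leq_div2r // ltnW.
rewrite /= !inordK // => Ed; apply/val_inj => /=.
by rewrite (divn_eq y M) (divn_eq y' M) Ed -E -E'.
Qed.

Definition interval_sum (n : nat) (w : algC) (X : nat) (h : 'I_n.+2) : algC :=
  \sum_(x < X) Zp_char w (h * x%:R).

(** Expanding the square and summing over [h] leaves the pairs [x], [y] congruent modulo $M = m/g$,
    with weight at most $M$; each [x] has at most $X/M + 1$ partners. *)
Lemma interval_sum_L2 (n g : nat) (w : algC) (X : nat) : n.+2.-primitive_root w ->
  (g %| n.+2)%N ->
  \sum_(h < n.+2 | (g %| h)%N) `|interval_sum w X h| ^+ 2 <= (X * X + n.+2 %/ g * X)%:R.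
Proof.
move=> pw gm; set M := (n.+2 %/ g)%N.
have g0 : (0 < g)%N by apply: dvdn_gt0 gm.
have M0 : (0 < M)%N by rewrite divn_gt0 // dvdn_leq.
apply: (@le_trans _ _ (\sum_(x < X) \sum_(y < X) M * (x == y %[mod M]))%N%:R).
  under eq_bigr => h _.
    rewrite normCK {2}/interval_sum rmorph_sum mulr_suml /=.
    under eq_bigr => x _ do rewrite mulr_sumr.
    over.
  rewrite exchange_big natr_sum /=; apply: ler_sum => x _.
  rewrite exchange_big natr_sum /=; apply: ler_sum => y _.
  under eq_bigr => h _ do rewrite conj_Zp_char // -Zp_charD // -mulrN -mulrDr.
  have /andP[_ s1] := sum_Zp_char_le (x%:R - y%:R) pw gm.
  apply: le_trans s1 _; rewrite ler_nat leq_mul2l; apply/orP; right.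
  case: eqP => // E; rewrite lt0b.
  have : (g * x = g * y %[mod n.+2])%N.
    rewrite -!Zp_natr_val !natrM; congr (val _).
    by apply/eqP; rewrite -subr_eq0 -mulrBr E.
  rewrite -[n.+2](divnK gm) -/M [(M * g)%N]mulnC -!muln_modr // => /eqP.
  by rewrite eqn_pmul2l.
rewrite ler_nat; apply: (@leq_trans (\sum_(x < X) M * (X %/ M).+1)%N).
  apply: leq_sum => x _; rewrite -big_distrr /= leq_mul2l.
  by rewrite sum_nat_modn_eq ?orbT.
rewrite big_const_ord iter_addn_0 mulnS mulnDl addnC leq_add2r leq_mul2r.
by rewrite mulnC leq_trunc_div orbT.
Qed.

(** By orthogonality the sum is a multiple of the number of ways to write a point of the hyperbola
    as [(x1 + x2 + 1, y1 + y2 + 1)]. Two summands per coordinate make each Fourier weight a square,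
    so that mean-square bounds for [interval_sum] suffice. *)
Lemma box_character_sum_eq0 (n : nat) (w : algC) (a : 'I_n.+2) (X Y : nat) :
  n.+2.-primitive_root w -> a \is a GRing.unit ->
  (forall (x1 x2 : 'I_X) (y1 y2 : 'I_Y),
     (x1 + x2 + 1)%:R * (y1 + y2 + 1)%:R != a :> 'I_n.+2) ->
  \sum_(h < n.+2) \sum_(k < n.+2) kloosterman w a h k * (Zp_char w (- h) * Zp_char w (- k))
    * ((interval_sum w X h)^* ^+ 2 * (interval_sum w Y k)^* ^+ 2) = 0.
Proof.
move=> pw ua none.
pose T (h k u : 'I_n.+2) (x1 x2 : 'I_X) (y1 y2 : 'I_Y) :=
  Zp_char w (h * (u - (x1 + x2 + 1)%:R)) * Zp_char w (k * (a / u - (y1 + y2 + 1)%:R)).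
transitivity (\sum_(h < n.+2) \sum_(k < n.+2) \sum_(u : 'I_n.+2 | u \is a GRing.unit)
  \sum_(x1 < X) \sum_(x2 < X) \sum_(y1 < Y) \sum_(y2 < Y) T h k u x1 x2 y1 y2).
  apply: eq_bigr => h _; apply: eq_bigr => k _.
  rewrite -mulrA mulr_suml; apply: eq_bigr => u uu.
  have EC Z (l : 'I_n.+2) : (interval_sum w Z l)^* = \sum_(x < Z) Zp_char w (- (l * x%:R)).
    by rewrite rmorph_sum /=; apply: eq_bigr => x _; rewrite conj_Zp_char.
  have E2 Z (l : 'I_n.+2) : (interval_sum w Z l)^* ^+ 2 =
      \sum_(x < Z) \sum_(y < Z) Zp_char w (- (l * x%:R)) * Zp_char w (- (l * y%:R)).
    by rewrite expr2 EC big_distrlr.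
  rewrite !E2 mulrA mulr_suml mulr_sumr; apply: eq_bigr => x1 _.
  rewrite mulr_suml mulr_sumr; apply: eq_bigr => x2 _.
  rewrite !mulr_sumr; apply: eq_bigr => y1 _.
  rewrite !mulr_sumr; apply: eq_bigr => y2 _.
  by rewrite /T -!Zp_charD // !natrD; congr (Zp_char _ _); ring.
under eq_bigr => h _ do rewrite exchange_big /=.
rewrite exchange_big /=; apply: big1 => u uu.
under eq_bigr => h _ do rewrite exchange_big /=.
rewrite exchange_big /=; apply: big1 => x1 _.
under eq_bigr => h _ do rewrite exchange_big /=.
rewrite exchange_big /=; apply: big1 => x2 _.
under eq_bigr => h _ do rewrite exchange_big /=.
rewrite exchange_big /=; apply: big1 => y1 _.
under eq_bigr => h _ do rewrite exchange_big /=.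
rewrite exchange_big /=; apply: big1 => y2 _.
under eq_bigr => h _ do rewrite -mulr_sumr.
rewrite -mulr_suml.
have orth z : z != 0 -> \sum_(i : 'I_n.+2) Zp_char w (i * z) = 0.
  move=> z0; have := @sum_Zp_char_eq0 n 1 w z pw (dvd1n _); rewrite mul1r => /(_ z0).
  by move=> {2}<-; apply: eq_bigl => h; rewrite dvd1n.
have [Eu|nu] := eqVneq (u - (x1 + x2 + 1)%:R) 0; last by rewrite orth // mul0r.
rewrite [X in _ * X]orth ?mulr0 //.
apply: contra (none x1 x2 y1 y2); rewrite !subr_eq0 => /eqP <-.
by move/eqP: Eu; rewrite subr_eq0 => /eqP <-; rewrite mulrCA divrr // mulr1.
Qed.

Lemma kloosterman00 (n : nat) (w : algC) (a : 'I_n.+2) :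
  kloosterman w a 0 0 = (totient n.+2)%:R.
Proof.
rewrite -sum_unit_Zp natr_sum; apply: eq_bigr => u _.
by rewrite !mul0r addr0 Zp_char0.
Qed.

Lemma interval_sum0 (n : nat) (w : algC) (X : nat) : interval_sum w X (0 : 'I_n.+2) = X%:R.
Proof.
rewrite /interval_sum (eq_bigr (fun _ => 1)) => [|x _]; first by rewrite sumr_const card_ord.
by rewrite mul0r Zp_char0.
Qed.

(** In an empty box the other frequencies have to cancel the contribution of [(0, 0)], which is the
    left-hand side. *)
Lemma box_main_term (n : nat) (w : algC) (a : 'I_n.+2) (X Y : nat) :
  n.+2.-primitive_root w -> a \is a GRing.unit ->
  (forall (x1 x2 : 'I_X) (y1 y2 : 'I_Y),
     (x1 + x2 + 1)%:R * (y1 + y2 + 1)%:R != a :> 'I_n.+2) ->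
  (totient n.+2 * (X * Y) ^ 2)%:R <=
  \sum_(p : 'I_n.+2 * 'I_n.+2 | p != (0, 0)) `|kloosterman w a p.1 p.2|
     * (`|interval_sum w X p.1| ^+ 2 * `|interval_sum w Y p.2| ^+ 2).
Proof.
move=> pw ua none; have := box_character_sum_eq0 pw ua none.
rewrite pair_bigA /= (bigD1 (0, 0)) //= kloosterman00 !interval_sum0.
rewrite oppr0 Zp_char0 !mulr1 !conjC_nat => /eqP; rewrite addr_eq0 => /eqP E.
have -> : (totient n.+2 * (X * Y) ^ 2)%:R = `|(totient n.+2)%:R * (X%:R ^+ 2 * Y%:R ^+ 2)| :> algC.
  by rewrite -!natrX -!natrM normr_nat expnMn.
rewrite E normrN; apply: le_trans (ler_norm_sum _ _ _) _; apply: ler_sum => p _.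
by rewrite !normrM !(norm_Zp_char _ pw) !mulr1 !norm_conjC -!expr2.
Qed.

(** Multiply the two mean-square bounds and remove the term $X^2 Y^2$ of the zero frequency: with $M
    = m/g$ there remains $X Y (M X + M Y + M^2)$, and $g M = m$. *)
Lemma nonzero_frequency_mass (n g : nat) (w : algC) (X Y : nat) : n.+2.-primitive_root w ->
  (g %| n.+2)%N -> (X <= n.+2)%N -> (Y <= n.+2)%N ->
  g%:R * \sum_(p : 'I_n.+2 * 'I_n.+2 | (p != (0, 0)) && ((g %| p.1) && (g %| p.2))%N)
     `|interval_sum w X p.1| ^+ 2 * `|interval_sum w Y p.2| ^+ 2
   <= (3 * n.+2 ^ 2 * (X * Y))%:R.
Proof.
move=> pw gm Xm Ym; set M := (n.+2 %/ g)%N.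
have EM : (g * M = n.+2)%N by rewrite mulnC divnK.
have Mm : (M <= n.+2)%N by apply: leq_div.
set S := \sum_(p | _) _.
have : S + (X * X * (Y * Y))%:R <= ((X * X + M * X) * (Y * Y + M * Y))%:R.
  have := ler_pM _ _ (interval_sum_L2 X pw gm) (interval_sum_L2 Y pw gm).
  rewrite -/M -natrM => H.
  apply: le_trans (H _ _); try by apply: sumr_ge0 => ? _; rewrite exprn_ge0.
  rewrite big_distrlr pair_big /= [leRHS](bigD1 (0, 0)) ?dvdn0 //= !interval_sum0 !normr_nat.
  rewrite -!natrX -!natrM !expnS !expn0 !muln1 addrC lerD2r.
  by rewrite /S le_eqVlt; apply/orP; left; apply/eqP/eq_bigl => p; rewrite andbC.
rewrite -lerBrDr -natrB => [H|]; last by nia.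
apply: le_trans (ler_wpM2l (ler0n _ g) H) _; rewrite -natrM ler_nat.
apply: (@leq_trans (g * (X * Y * (M * Y + X * M + M * M)))%N); first by rewrite leq_mul2l; lia.
rewrite (_ : g * _ = X * Y * (g * M * Y + X * (g * M) + g * M * M))%N; last by ring.
rewrite EM mulnC leq_mul2r; apply/orP; right; rewrite !expnS expn0; nia.
Qed.

(** The error terms are grouped by $g = \gcd(h, k, m)$, and each divisor $g$ contributes at most $3
    \kappa m^2 X Y$, where $\kappa$ is [kap]. Against the main term $\varphi(m) (X Y)^2$ this gives
    $X Y \le 3 \kappa m \tau(m)^2$; the fourth power has the constant $81 \cdot 2 = 162$. *)
Theorem box_bound (n : nat) (a : 'I_n.+2) (X Y : nat) : a \is a GRing.unit ->
  (X <= n.+2)%N -> (Y <= n.+2)%N ->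
  (forall (x1 x2 : 'I_X) (y1 y2 : 'I_Y),
     (x1 + x2 + 1)%:R * (y1 + y2 + 1)%:R != a :> 'I_n.+2) ->
  ((X * Y) ^ 4 <= 162 * tau n.+2 ^ 11 * n.+2 ^ 7)%N.
Proof.
move=> ua Xm Ym none.
have [w pw] := C_prim_root_exists (ltn0Sn n.+1).
set m := n.+2 in Xm Ym *.
have [->//|XY0] := posnP (X * Y).
pose kap : algC := 4.-root (2 * m ^ 3 * tau m ^ 3)%:R.
have Ekap : kap ^+ 4 = (2 * m ^ 3 * tau m ^ 3)%:R by rewrite rootCK.
have kap0 : 0 <= kap by rewrite rootC_ge0.
have Kle h k : `|kloosterman w a h k| <= kap * (gcdn (gcdn h k) n.+2)%:R.
  rewrite -(@ler_pXn2r _ 4) ?nnegrE ?mulr_ge0 // exprMn Ekap -natrX -natrM.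
  apply: le_trans (kloosterman_bound _ _ pw ua) _; rewrite ler_nat leq_mul2l.
  by rewrite -[leqLHS]expn1 leq_pexp2l ?orbT // gcdn_gt0 orbT.
have main := box_main_term pw ua none.
have : (totient m * (X * Y) ^ 2)%:R <= (tau m)%:R * (kap * (3 * m ^ 2 * (X * Y))%:R).
  apply: le_trans main _.
  (* Each frequency is counted for every common divisor [g] of its coordinates and the modulus; the
     largest such [g] already majorizes its term. *)
  apply: (@le_trans _ _ (\sum_(g <- divisors m) \sum_(p : 'I_n.+2 * 'I_n.+2 | p != (0, 0))
     ((g %| p.1) && (g %| p.2))%N%:R * (kap * g%:R *
       (`|interval_sum w X p.1| ^+ 2 * `|interval_sum w Y p.2| ^+ 2)))).
    rewrite exchange_big /=; apply: ler_sum => p _.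
    set W := (X in _ * X <= _); have W0 : 0 <= W by rewrite mulr_ge0 ?exprn_ge0.
    set g := gcdn (gcdn p.1 p.2) n.+2.
    rewrite (big_rem g) /=; last by rewrite -dvdn_divisors //; apply: dvdn_gcdr.
    apply: ler_wpDr; first by apply: sumr_ge0 => d _; rewrite !mulr_ge0.
    have -> : (g %| p.1)%N by apply: dvdn_trans (dvdn_gcdl _ _) (dvdn_gcdl _ _).
    have -> : (g %| p.2)%N by apply: dvdn_trans (dvdn_gcdl _ _) (dvdn_gcdr _ _).
    rewrite mul1r.
    by rewrite ler_wpM2r.
  rewrite -[(tau m)%:R]mulr1 /tau -sum1_size natr_sum mulr1 mulr_suml.
  rewrite big_seq [leRHS]big_seq; apply: ler_sum => g; rewrite -dvdn_divisors // => gm.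
  rewrite mul1r; apply: le_trans (ler_wpM2l kap0 (nonzero_frequency_mass pw gm Xm Ym)).
  rewrite big_mkcondr mulrA mulr_sumr /=; apply: ler_sum => p _.
  by case: ifP => _; rewrite ?mul1r // mul0r mulr0.
move=> H.
have H1 : (X * Y)%:R <= kap * (3 * m * tau m ^ 2)%:R.
  have P : 0 < (m * (X * Y))%:R :> algC by rewrite ltr0n muln_gt0.
  rewrite -(ler_pM2l P).
  apply: (@le_trans _ _ ((tau m)%:R * (totient m * (X * Y) ^ 2)%:R)).
    rewrite -!natrM ler_nat -mulnA mulnn mulnA leq_mul2r; apply/orP; right.
    by apply: leq_tau_totient.
  apply: le_trans (ler_wpM2l (ler0n _ _) H) _.
  by rewrite !natrM ?natrX le_eqVlt; apply/orP; left; apply/eqP; ring.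
have := lerXn2r 4 (ler0n _ _ : (_ : algC) \is Num.nneg) _ H1.
rewrite nnegrE mulr_ge0 // => /(_ isT); rewrite exprMn Ekap -!natrX -natrM ler_nat.
move=> /leq_trans; apply; apply/eq_leq; ring.
Qed.

(** * Convex chains on a modular hyperbola *)

(** The map $s \mapsto s X / (s X + Y)$ is increasing, so its lower bound $c/Q$ at $s = al/be$
    persists at the larger slope $e/d$. *)
Lemma chord_slope_ge (al be d e X Y Q c : int) :
  0 < al -> 0 < be -> 0 < d -> 0 < e -> 0 < X -> 0 < Y -> 0 <= c ->
  al * d <= be * e -> c * (al * X + be * Y) <= Q * (al * X) ->
  c * (e * X + d * Y) <= Q * (e * X).
Proof.
move=> al0 be0 d0 e0 X0 Y0 c0 le1 le2.
have le3 : c * (be * Y) <= (Q - c) * (al * X) by lia.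
have Qc : 0 <= Q - c.
  by rewrite -(pmulr_lge0 _ (mulr_gt0 al0 X0)) (le_trans _ le3) // !mulr_ge0 // ltW.
suff : be * (c * (d * Y)) <= be * ((Q - c) * (e * X)) by rewrite ler_pM2l //; lia.
apply: (@le_trans _ _ ((Q - c) * X * (al * d))).
  rewrite (_ : be * _ = d * (c * (be * Y))); last by ring.
  rewrite (_ : _ * (al * d) = d * ((Q - c) * (al * X))); last by ring.
  by rewrite ler_pM2l.
rewrite (_ : be * _ = (Q - c) * X * (be * e)); last by ring.
by apply: ler_wpM2l => //; rewrite mulr_ge0 // ltW.
Qed.

Lemma chord_slope_le (al be d e X Y Q c : int) :
  0 < al -> 0 < be -> 0 < d -> 0 < e -> 0 < X -> 0 < Y -> 0 <= c ->
  be * e <= al * d -> Q * (al * X) <= c * (al * X + be * Y) ->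
  Q * (e * X) <= c * (e * X + d * Y).
Proof.
move=> al0 be0 d0 e0 X0 Y0 c0 le1 le2.
have le3 : (Q - c) * (al * X) <= c * (be * Y) by lia.
suff : be * ((Q - c) * (e * X)) <= be * (c * (d * Y)) by rewrite ler_pM2l //; lia.
have [Qc|/ltW Qc] := leP 0 (Q - c); last first.
  apply: (@le_trans _ _ 0); last by rewrite !mulr_ge0 // ltW.
  by rewrite pmulr_rle0 // mulr_le0_ge0 // mulr_ge0 // ltW.
apply: (@le_trans _ _ ((Q - c) * X * (al * d))).
  rewrite (_ : be * _ = (Q - c) * X * (be * e)); last by ring.
  by apply: ler_wpM2l => //; rewrite mulr_ge0 // ltW.
rewrite (_ : be * _ = d * (c * (be * Y))); last by ring.
rewrite (_ : _ * (al * d) = d * ((Q - c) * (al * X))); last by ring.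
by rewrite ler_pM2l.
Qed.

(** With $f = e_1 X + d_1 Y$ and $h = e_2 X + d_2 Y$, the cross product times $X Y$ equals $f h$
    times the difference of $e_1 X / f$ and $e_2 X / h$. That difference is at most $1/Q$, while $f$
    and $h$ are below $2 X Y / Q$. *)
Lemma cell_cross_lt (d1 e1 d2 e2 X Y Q c : int) : 0 < Q -> 0 < X -> 0 < Y ->
  0 < d1 -> 0 < e1 -> 0 < d2 -> 0 < e2 ->
  Q * d1 < X -> Q * e1 < Y -> Q * d2 < X -> Q * e2 < Y ->
  Q * (e1 * X) <= (c + 1) * (e1 * X + d1 * Y) ->
  c * (e2 * X + d2 * Y) <= Q * (e2 * X) ->
  Q ^+ 3 * (e1 * d2 - e2 * d1) < 4 * (X * Y).
Proof.
move=> Q0 X0 Y0 d10 e10 d20 e20 qd1 qe1 qd2 qe2 le1 le2.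
have XY0 : 0 < X * Y by rewrite mulr_gt0.
rewrite -(ltr_pM2l XY0).
pose f := e1 * X + d1 * Y; pose h := e2 * X + d2 * Y.
have f0 : 0 < f by rewrite addr_gt0 // mulr_gt0.
have h0 : 0 < h by rewrite addr_gt0 // mulr_gt0.
have fQ : Q * f < 2 * (X * Y).
  rewrite /f (_ : Q * _ = Q * e1 * X + Q * d1 * Y); last by ring.
  have : Q * e1 * X < Y * X by rewrite ltr_pM2r.
  have : Q * d1 * Y < X * Y by rewrite ltr_pM2r.
  by lia.
have hQ : Q * h < 2 * (X * Y).
  rewrite /h (_ : Q * _ = Q * e2 * X + Q * d2 * Y); last by ring.
  have : Q * e2 * X < Y * X by rewrite ltr_pM2r.
  have : Q * d2 * Y < X * Y by rewrite ltr_pM2r.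
  by lia.
apply: (@le_lt_trans _ _ (Q * f * (Q * h))).
  rewrite (_ : X * Y * _ = Q ^+ 2 * (Q * (e1 * X) * h - Q * (e2 * X) * f)); last first.
    by rewrite /f /h; ring.
  rewrite (_ : Q * f * _ = Q ^+ 2 * ((c + 1) * f * h - c * h * f)); last by ring.
  rewrite ler_pM2l ?exprn_gt0 //; apply: lerB; first by rewrite ler_pM2r.
  by rewrite ler_pM2r.
rewrite (_ : X * Y * _ = 2 * (X * Y) * (2 * (X * Y))); last by ring.
by apply: ltr_pM => //; rewrite mulr_ge0 // ltW.
Qed.

(** The expression is the determinant of the rows $(s_i, t_i, s_i t_i)$. Adding $y_0$ times the
    first column and $x_0$ times the second to the last turns the last one into $(x_0 + s_i)(y_0 +
    t_i) - x_0 y_0$, which [m] divides. *)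
Lemma det_dvd (m x0 y0 s1 t1 s2 t2 s t : int) :
  (m %| (x0 + s1) * (y0 + t1) - x0 * y0)%Z -> (m %| (x0 + s2) * (y0 + t2) - x0 * y0)%Z ->
  (m %| (x0 + s) * (y0 + t) - x0 * y0)%Z ->
  (m %| s1 * t1 * (s2 * t - s * t2) - s2 * t2 * (s1 * t - s * t1) + s * t * (s1 * t2 - s2 * t1))%Z.
Proof.
move=> m1 m2 m3.
rewrite (_ : _ + _ = ((x0 + s1) * (y0 + t1) - x0 * y0) * (s2 * t - s * t2)
  - ((x0 + s2) * (y0 + t2) - x0 * y0) * (s1 * t - s * t1)
  + ((x0 + s) * (y0 + t) - x0 * y0) * (s1 * t2 - s2 * t1)); last by ring.
by rewrite rpredD ?rpredB ?dvdz_mulr.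
Qed.

(* A vector [(s, t)], up to sign, of negative slope, fitting into an [X/Q] by [Y/Q] box, whose
   slope [e/d] is such that [e X / (e X + d Y)] lies in [[c/Q, (c+1)/Q]]. *)
Definition short_chord (Q X Y c s t : int) : Prop :=
  exists d e eps : int, [/\ eps ^+ 2 = 1, s = eps * d, t = - (eps * e),
    [/\ 0 < d, 0 < e, Q * d < X & Q * e < Y]
    & c * (e * X + d * Y) <= Q * (e * X) <= (c + 1) * (e * X + d * Y)].

Lemma norm_sign (eps x : int) : eps ^+ 2 = 1 -> `|eps * x| = `|x|.
Proof.
move=> /eqP; rewrite -(expr1n _ 2) eqf_sqr => /orP[] /eqP->; first by rewrite mul1r.
by rewrite mulN1r normrN.
Qed.

Lemma short_chord_cross (Q X Y c s1 t1 s2 t2 : int) : 0 < Q -> 0 < X -> 0 < Y ->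
  short_chord Q X Y c s1 t1 -> short_chord Q X Y c s2 t2 ->
  Q ^+ 3 * `|s1 * t2 - s2 * t1| < 4 * (X * Y).
Proof.
move=> Q0 X0 Y0 [d1 [e1 [p1 [E1 -> -> [d10 e10 qd1 qe1] /andP[lo1 up1]]]]].
move=> [d2 [e2 [p2 [E2 -> -> [d20 e20 qd2 qe2] /andP[lo2 up2]]]]].
rewrite (_ : _ - _ = (p1 * p2) * (e1 * d2 - e2 * d1)); last by ring.
rewrite norm_sign; last by rewrite exprMn E1 E2 mulr1.
case: (ger0P (e1 * d2 - e2 * d1)) => _; first by apply: cell_cross_lt up1 lo2.
by rewrite opprB; apply: cell_cross_lt up2 lo1.
Qed.

Lemma short_chord_area (Q X Y c s t : int) : 0 < Q -> 0 < X -> 0 < Y ->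
  short_chord Q X Y c s t -> Q ^+ 2 * `|s * t| < X * Y.
Proof.
move=> Q0 X0 Y0 [d [e [p [E -> -> [d0 e0 qd qe] _]]]].
rewrite (_ : p * d * - (p * e) = - (p ^+ 2 * (d * e))); last by ring.
rewrite normrN E mul1r gtr0_norm ?mulr_gt0 //.
rewrite (_ : Q ^+ 2 * _ = (Q * d) * (Q * e)); last by ring.
by apply: ltr_pM => //; rewrite mulr_ge0 // ltW.
Qed.

(** Each of the three terms is an area below $X Y / Q^2$ times a cross product below $4 X Y / Q^3$;
    hence $|D| < 12 (X Y)^2 / Q^5 \le m$. *)
Lemma short_chord_det (m Q X Y c s1 t1 s2 t2 s t : int) : 0 < Q -> 0 < X -> 0 < Y ->
  12 * (X * Y) ^+ 2 <= m * Q ^+ 5 ->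
  short_chord Q X Y c s1 t1 -> short_chord Q X Y c s2 t2 -> short_chord Q X Y c s t ->
  let D := s1 * t1 * (s2 * t - s * t2) - s2 * t2 * (s1 * t - s * t1)
           + s * t * (s1 * t2 - s2 * t1) in
  (m %| D)%Z -> D = 0.
Proof.
move=> Q0 X0 Y0 mQ c1 c2 c3 D mD.
have term s' t' z : short_chord Q X Y c s' t' -> Q ^+ 3 * `|z| < 4 * (X * Y) ->
    Q ^+ 5 * `|s' * t' * z| < 4 * (X * Y) ^+ 2.
  move=> c' lz; have la := short_chord_area Q0 X0 Y0 c'.
  rewrite normrM (_ : Q ^+ 5 * _ = (Q ^+ 2 * `|s' * t'|) * (Q ^+ 3 * `|z|)); last by ring.
  rewrite (_ : 4 * _ = X * Y * (4 * (X * Y))); last by ring.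
  by apply: ltr_pM => //; rewrite mulr_ge0 ?exprn_ge0 // ltW.
have l1 := term _ _ _ c1 (short_chord_cross Q0 X0 Y0 c2 c3).
have l2 := term _ _ _ c2 (short_chord_cross Q0 X0 Y0 c1 c3).
have l3 := term _ _ _ c3 (short_chord_cross Q0 X0 Y0 c1 c2).
have lD : Q ^+ 5 * `|D| < 12 * (X * Y) ^+ 2.
  apply: (@le_lt_trans _ _ (Q ^+ 5 * `|s1 * t1 * (s2 * t - s * t2)|
     + Q ^+ 5 * `|s2 * t2 * (s1 * t - s * t1)| + Q ^+ 5 * `|s * t * (s1 * t2 - s2 * t1)|)).
    rewrite -!mulrDr ler_pM2l ?exprn_gt0 //.
    by apply: le_trans (ler_normD _ _) _; rewrite lerD2r; apply: ler_normB.
  by lia.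
have {}lD : `|D| < m.
  by rewrite -(@ltr_pM2l _ (Q ^+ 5)) ?exprn_gt0 // (lt_le_trans lD) // [Q ^+ 5 * m]mulrC.
apply/eqP; apply: contraLR lD => D0; rewrite -leNgt.
move: mD; rewrite dvdzE => /dvdn_leq; rewrite absz_gt0 D0 => /(_ isT).
by lia.
Qed.

Section Chain.
(** The linear form with coefficients [al v], [be v] attains its strict minimum over the chain at
    [v], so that [- al v / be v] is the slope of a supporting line there. *)
Variables (T : finType) (E : {set T}) (x y al be : T -> nat).
Hypothesis pos : {in E, forall v, [/\ 0 < x v, 0 < y v, 0 < al v & 0 < be v]%N}.
Hypothesis exposed : {in E &, forall v w, v != w ->
  (al v * x v + be v * y v < al v * x w + be v * y w)%N}.

Lemma chain_x_inj : {in E &, injective x}.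
Proof.
move=> v w vE wE Ex; apply: contraTeq isT => vw.
have := exposed vE wE vw; have := exposed wE vE; rewrite eq_sym => /(_ vw).
by rewrite Ex !ltn_add2l !ltn_mul2l => /andP[_ /ltn_trans H] /andP[_ /H]; rewrite ltnn.
Qed.

Lemma chain_antitone v w : v \in E -> w \in E -> (x v < x w)%N -> (y w < y v)%N.
Proof.
move=> vE wE xvw; have wv : w != v by apply: contraTneq xvw => ->; rewrite ltnn.
have [_ _ a0 b0] := pos wE; have := exposed wE vE wv.
by rewrite ltnNge; apply: contraNltn => yvw; rewrite leq_add // leq_mul2l ?(ltnW xvw) ?yvw orbT.
Qed.

(** The absolute slope of the chord lies strictly between [al w / be w] and [al v / be v]. *)
Lemma chain_slope v w : v \in E -> w \in E -> (x v < x w)%N -> (al w * be v < al v * be w)%N.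
Proof.
move=> vE wE xvw; have yvw := chain_antitone vE wE xvw.
have wv : w != v by apply: contraTneq xvw => ->; rewrite ltnn.
have := exposed vE wE; rewrite eq_sym => /(_ wv); have := exposed wE vE wv.
have [_ _ a0 b0] := pos wE; have [_ _ a0' b0'] := pos vE.
move=> l1 l2.
have {}l1 : (al w * (x w - x v) < be w * (y v - y w))%N by nia.
have {}l2 : (be v * (y v - y w) < al v * (x w - x v))%N by nia.
have d0 : (0 < x w - x v)%N by rewrite subn_gt0.
move: l1 l2 d0; set d := (x w - x v)%N; set e := (y v - y w)%N => l1 l2 d0.
rewrite -(ltn_pmul2r d0).
have h1 : (al w * d * be v < be w * e * be v)%N by rewrite ltn_pmul2r.
have h2 : (be v * e * be w < al v * d * be w)%N by rewrite ltn_pmul2r.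
by lia.
Qed.

(** The form of the middle point [v] increases strictly towards [u] and towards [w]. Weighting these
    increments by the opposite horizontal gaps cancels the [x] part and leaves [be v] times the
    cross product, which is therefore positive. *)
Lemma chain_cross_neq0 u v w : u \in E -> v \in E -> w \in E -> (x u < x v < x w)%N ->
  ((x v)%:Z - (x u)%:Z) * ((y w)%:Z - (y u)%:Z)
    - ((x w)%:Z - (x u)%:Z) * ((y v)%:Z - (y u)%:Z) != 0.
Proof.
move=> uE vE wE /andP[uv vw].
have nuv : v != u by apply: contraTneq uv => ->; rewrite ltnn.
have nvw : v != w by apply: contraTneq vw => ->; rewrite ltnn.
have l1 := exposed vE uE nuv; have l2 := exposed vE wE nvw.
apply/eqP => cr.
have [_ _ a0 b0] := pos vE.
pose p := (x v)%:Z - (x u)%:Z; pose q := (x w)%:Z - (x v)%:Z.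
have p0 : 0 < p by rewrite /p; lia.
have q0 : 0 < q by rewrite /q; lia.
have {}l1 : 0 < (al v)%:Z * ((x u)%:Z - (x v)%:Z) + (be v)%:Z * ((y u)%:Z - (y v)%:Z) by lia.
have {}l2 : 0 < (al v)%:Z * ((x w)%:Z - (x v)%:Z) + (be v)%:Z * ((y w)%:Z - (y v)%:Z) by lia.
have l3 := mulr_gt0 q0 l1; have l4 := mulr_gt0 p0 l2.
have : 0 < (be v)%:Z * (((x v)%:Z - (x u)%:Z) * ((y w)%:Z - (y u)%:Z)
   - ((x w)%:Z - (x u)%:Z) * ((y v)%:Z - (y u)%:Z)).
  rewrite (_ : _ * _ = q * ((al v)%:Z * ((x u)%:Z - (x v)%:Z) + (be v)%:Z * ((y u)%:Z - (y v)%:Z))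
     + p * ((al v)%:Z * ((x w)%:Z - (x v)%:Z) + (be v)%:Z * ((y w)%:Z - (y v)%:Z))).
    exact: addr_gt0.
  by rewrite /p /q; ring.
by rewrite cr mulr0 ltxx.
Qed.

Lemma chain_y_inj : {in E &, injective y}.
Proof.
move=> v w vE wE Ey; apply: (chain_x_inj vE wE); apply/eqP.
by case: ltngtP => // /chain_antitone; [move/(_ vE wE)|move/(_ wE vE)]; rewrite Ey ltnn.
Qed.

Lemma chain_noncollinear u v w : u \in E -> v \in E -> w \in E -> u != v -> v != w -> w != u ->
  ((x v)%:Z - (x u)%:Z) * ((y w)%:Z - (y u)%:Z)
    - ((x w)%:Z - (x u)%:Z) * ((y v)%:Z - (y u)%:Z) != 0.
Proof.
move=> uE vE wE uv vw wu.
pose cr u v w := ((x v)%:Z - (x u)%:Z) * ((y w)%:Z - (y u)%:Z)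
                 - ((x w)%:Z - (x u)%:Z) * ((y v)%:Z - (y u)%:Z).
have rot a b c : cr a b c = cr b c a by rewrite /cr; ring.
have swap a b c : cr a c b = - cr a b c by rewrite /cr; ring.
have mid a b c : a \in E -> b \in E -> c \in E -> (x a < x b < x c)%N -> cr a b c != 0.
  exact: chain_cross_neq0.
have ne a b : a \in E -> b \in E -> a != b -> x a != x b.
  by move=> aE bE; apply: contraNneq => /(chain_x_inj aE bE)->.
have := ne _ _ uE vE uv; have := ne _ _ vE wE vw; have := ne _ _ wE uE wu.
rewrite -[_ - _]/(cr u v w).
move=> n1 n2 n3.
have m1 : (x u < x v < x w)%N -> cr u v w != 0 by apply: mid.
have m2 : (x v < x w < x u)%N -> cr u v w != 0 by rewrite rot; apply: mid.
have m3 : (x w < x u < x v)%N -> cr u v w != 0 by rewrite -rot; apply: mid.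
have m4 : (x u < x w < x v)%N -> cr u v w != 0 by rewrite -oppr_eq0 -swap; apply: mid.
have m5 : (x w < x v < x u)%N -> cr u v w != 0 by rewrite -oppr_eq0 -swap rot; apply: mid.
have m6 : (x v < x u < x w)%N -> cr u v w != 0 by rewrite -oppr_eq0 -swap -rot; apply: mid.
have : [|| x u < x v < x w, x v < x w < x u, x w < x u < x v
  | [|| x u < x w < x v, x w < x v < x u | x v < x u < x w]]%N by lia.
by case/or4P => //; case/or3P.
Qed.

Variables (m Q : nat).
Hypothesis Q_gt0 : (0 < Q)%N.

Definition x_cell (X : nat) v := (x v * Q %/ X)%N.
Definition y_cell (Y : nat) v := (y v * Q %/ Y)%N.
(** After rescaling the [X] by [Y] box to a square, the map $s \mapsto s/(s+1)$ sends all positive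
    slopes into $(0, 1)$, which is cut into [Q] equal parts. *)
Definition slope_cell (X Y : nat) v := (Q * (al v * X) %/ (al v * X + be v * Y))%N.

Lemma slope_cellP (X Y : nat) v : v \in E -> (0 < X)%N -> (0 < Y)%N ->
  (slope_cell X Y v)%:Z * ((al v)%:Z * X%:Z + (be v)%:Z * Y%:Z) <= Q%:Z * ((al v)%:Z * X%:Z)
    <= ((slope_cell X Y v)%:Z + 1) * ((al v)%:Z * X%:Z + (be v)%:Z * Y%:Z).
Proof.
move=> vE X0 Y0; have [_ _ a0 b0] := pos vE.
have D0 : (0 < al v * X + be v * Y)%N by rewrite addn_gt0 muln_gt0 a0 X0.
have := leq_trunc_div (Q * (al v * X)) (al v * X + be v * Y).
have := ltn_ceil (Q * (al v * X)) D0.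
by rewrite -/(slope_cell X Y v); lia.
Qed.

Lemma slope_cell_antitone (X Y : nat) v w : v \in E -> w \in E -> (0 < X)%N -> (0 < Y)%N ->
  (x v < x w)%N -> (slope_cell X Y w <= slope_cell X Y v)%N.
Proof.
move=> vE wE X0 Y0 xvw; have [_ _ a0 b0] := pos vE; have [_ _ a0' b0'] := pos wE.
rewrite {2}/slope_cell leq_divRL ?addn_gt0 ?muln_gt0 ?a0 ?X0 //.
have /andP[lo _] := slope_cellP wE X0 Y0.
have := chain_slope vE wE xvw => sl.
have := @chord_slope_ge (al w) (be w) (be v) (al v) X Y Q (slope_cell X Y w).
rewrite !ltz_nat => /(_ a0' b0' b0 a0 X0 Y0) H.
have : (slope_cell X Y w)%:Z * ((al v)%:Z * X%:Z + (be v)%:Z * Y%:Z) <= Q%:Z * ((al v)%:Z * X%:Z).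
  by apply: H => //; lia.
by lia.
Qed.

(** The signs make each summand nondecreasing along the chain, and the subtractions do not truncate
    when [y v < 2 * Y]. When also [x v < 2 * X], the label is at most [5 * Q]: a number of classes
    linear in [Q] instead of cubic. *)
Definition cell_label (X Y : nat) v :=
  (x_cell X v + (2 * Q - y_cell Y v) + (Q - slope_cell X Y v))%N.

Lemma slope_cell_le (X Y : nat) v : (slope_cell X Y v <= Q)%N.
Proof.
rewrite /slope_cell; case: (posnP (al v * X + be v * Y)) => [->|D0]; first by rewrite divn0.
by rewrite -ltnS ltn_divLR //; nia.
Qed.

Lemma y_cell_le (Y : nat) v : (0 < Y)%N -> (y v < 2 * Y)%N -> (y_cell Y v <= 2 * Q)%N.
Proof.
move=> Y0 yY; rewrite -ltnS ltn_divLR //; nia.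
Qed.

(* The three cells vary monotonically along the chain, hence their signed sum determines them. *)
Lemma cell_label_inj (X Y : nat) v w : v \in E -> w \in E -> (0 < X)%N -> (0 < Y)%N ->
  (y v < 2 * Y)%N -> (y w < 2 * Y)%N -> cell_label X Y v = cell_label X Y w ->
  [/\ x_cell X v = x_cell X w, y_cell Y v = y_cell Y w & slope_cell X Y v = slope_cell X Y w].
Proof.
move=> + + X0 Y0; wlog: v w / (x v <= x w)%N.
  move=> H vE wE yv yw; case/orP: (leq_total (x v) (x w)) => xvw El; first exact: H.
  by have [-> -> ->] := H _ _ xvw wE vE yw yv (esym El).
rewrite leq_eqVlt => /orP[/eqP Ex vE wE _ _ _|xvw vE wE yv yw].
  by rewrite (chain_x_inj vE wE Ex).
have h1 : (x_cell X v <= x_cell X w)%N by rewrite leq_div2r // leq_mul2r (ltnW xvw) orbT.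
have h2 : (y_cell Y w <= y_cell Y v)%N.
  by rewrite leq_div2r // leq_mul2r (ltnW (chain_antitone vE wE xvw)) orbT.
have h3 := slope_cell_antitone vE wE X0 Y0 xvw.
have h4 := slope_cell_le X Y v; have h5 := y_cell_le Y0 yv.
by rewrite /cell_label => El; split; lia.
Qed.

Lemma short_chordN (c s t X Y : int) :
  short_chord Q X Y c s t -> short_chord Q X Y c (- s) (- t).
Proof.
move=> [d [e [p [p1 -> -> H1 H2]]]]; exists d, e, (- p).
by rewrite sqrrN !mulNr.
Qed.

Lemma same_cell_dist (X a b : nat) : (0 < X)%N -> (a <= b)%N -> (a * Q %/ X = b * Q %/ X)%N ->
  Q%:Z * (b%:Z - a%:Z) < X%:Z.
Proof.
move=> X0 ab Eq; have := divn_eq (a * Q) X; have := divn_eq (b * Q) X.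
have := ltn_pmod (a * Q) X0; have := ltn_pmod (b * Q) X0; rewrite Eq; lia.
Qed.

(** The slope of the chord is squeezed between those of the supporting lines at its ends, which
    share a slope cell. *)
Lemma same_cell_chord (X Y : nat) v w : v \in E -> w \in E -> (0 < X)%N -> (0 < Y)%N -> v != w ->
  x_cell X v = x_cell X w -> y_cell Y v = y_cell Y w -> slope_cell X Y v = slope_cell X Y w ->
  short_chord Q X Y (slope_cell X Y v) ((x w)%:Z - (x v)%:Z) ((y w)%:Z - (y v)%:Z).
Proof.
move=> + + X0 Y0; wlog: v w / (x v <= x w)%N.
  move=> H vE wE vw E1 E2 E3; case/orP: (leq_total (x v) (x w)) => xvw; first exact: H.
  rewrite -opprB -[X in short_chord _ _ _ _ _ X]opprB; apply: short_chordN.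
  by rewrite E3; apply: H => //; rewrite eq_sym.
rewrite leq_eqVlt => /orP[/eqP Ex vE wE|xvw vE wE vw E1 E2 E3].
  by rewrite (chain_x_inj vE wE Ex) eqxx.
have yvw := chain_antitone vE wE xvw.
have [_ _ a0 b0] := pos vE; have [_ _ a0' b0'] := pos wE.
have l1 := exposed vE wE vw; have l2 := exposed wE vE; rewrite eq_sym in l2; have {}l2 := l2 vw.
exists ((x w)%:Z - (x v)%:Z), ((y v)%:Z - (y w)%:Z), 1.
have d0 : 0 < (x w)%:Z - (x v)%:Z by lia.
have e0 : 0 < (y v)%:Z - (y w)%:Z by lia.
split; rewrite ?expr1n ?mul1r ?opprB //.
  split=> //; first exact: same_cell_dist (ltnW xvw) E1.
  by apply: same_cell_dist (ltnW yvw) _.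
have /andP[_ up] := slope_cellP vE X0 Y0; have /andP[lo _] := slope_cellP wE X0 Y0.
apply/andP; split.
  by rewrite E3; apply: chord_slope_ge lo => //; lia.
by apply: chord_slope_le up => //; lia.
Qed.

Hypothesis lt_m : {in E, forall v, (x v < m)%N && (y v < m)%N}.
Hypothesis same_prod : {in E &, forall v w, x v * y v = x w * y w %[mod m]}.
Variable B : nat.
Hypothesis B_gt0 : (0 < B)%N.
Hypothesis tau_le : forall n, (0 < n <= m ^ 6)%N -> (tau n <= B)%N.

(* All points of a cell lie on the hyperbola [A s t + b s + c t = 0] through three of them,
   i.e. [(A s + c) (A t + b) = b c], so [A s + c] runs through divisors of [b c]. *)
Lemma cell_card (X Y : nat) (F : {set T}) : F \subset E -> (0 < X)%N -> (0 < Y)%N ->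
  (12 * (X * Y) ^ 2 <= m * Q ^ 5)%N ->
  {in F &, forall v w, [/\ x_cell X v = x_cell X w, y_cell Y v = y_cell Y w
                         & slope_cell X Y v = slope_cell X Y w]} ->
  (#|F| <= 2 * B)%N.
Proof.
move=> /fintype.subsetP FE X0 Y0 mQ same.
have [F2|] := leqP #|F| 2; first by apply: leq_trans F2 _; rewrite -{1}[2%N]muln1 leq_mul2l.
case/card_gt2P => p0 [p1 [p2 [[F0 F1 F2] [n01 n12 n20]]]].
pose s v : int := (x v)%:Z - (x p0)%:Z; pose t v : int := (y v)%:Z - (y p0)%:Z.
have chord v : v \in F -> v != p0 -> short_chord Q X Y (slope_cell X Y p0) (s v) (t v).
  move=> vF v0; have [E1 E2 E3] := same _ _ F0 vF.
  by apply: same_cell_chord => //; rewrite ?FE // eq_sym.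
have dv v : v \in F -> (m %| ((x p0)%:Z + s v) * ((y p0)%:Z + t v) - (x p0)%:Z * (y p0)%:Z)%Z.
  move=> vF; rewrite /s /t !subrKC -eqz_mod_dvd; apply/eqP.
  rewrite -!PoszM !modz_nat; congr Posz.
  exact: same_prod (FE _ vF) (FE _ F0).
(* The coefficients of the determinant expanded along the row of a variable fourth point; [A] is
   nonzero because no three points of the chain are collinear. *)
pose A : int := s p1 * t p2 - s p2 * t p1.
pose b : int := t p1 * t p2 * (s p2 - s p1); pose c : int := s p1 * s p2 * (t p1 - t p2).
have A0 : A != 0 by apply: chain_noncollinear; rewrite ?FE.
have curve v : v \in F -> A * (s v * t v) + b * s v + c * t v = 0.
  move=> vF; have [->|v0] := eqVneq v p0; first by rewrite /s /t !subrr !mulr0 !addr0.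
  rewrite (_ : _ + _ = s p1 * t p1 * (s p2 * t v - s v * t p2)
     - s p2 * t p2 * (s p1 * t v - s v * t p1)
     + s v * t v * (s p1 * t p2 - s p2 * t p1)); last by rewrite /A /b /c; ring.
  apply: (@short_chord_det m Q X Y (slope_cell X Y p0)); rewrite ?ltz_nat //.
  - by apply: chord; rewrite // eq_sym.
  - exact: chord.
  - exact: chord.
  by apply: det_dvd (dv _ F1) (dv _ F2) (dv _ vF).
have ns v w : v \in F -> w \in F -> v != w -> (x v)%:Z - (x w)%:Z != 0.
  move=> vF wF; apply: contraNneq => /eqP; rewrite subr_eq0 => /eqP [E1].
  by apply/eqP/chain_x_inj; rewrite ?FE.
have nt v w : v \in F -> w \in F -> v != w -> (y v)%:Z - (y w)%:Z != 0.
  move=> vF wF; apply: contraNneq => /eqP; rewrite subr_eq0 => /eqP [E1].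
  by apply/eqP/chain_y_inj; rewrite ?FE.
have n10 : p1 != p0 by rewrite eq_sym.
have n21 : p2 != p1 by rewrite eq_sym.
have Es : s p2 - s p1 = (x p2)%:Z - (x p1)%:Z by rewrite /s; ring.
have Et : t p1 - t p2 = (y p1)%:Z - (y p2)%:Z by rewrite /t; ring.
have bc0 : b * c != 0.
  by rewrite /b /c Es Et !mulf_neq0 ?ns ?nt.
have dx v w : v \in F -> w \in F -> (absz ((x v)%:Z - (x w)%:Z)%R <= m)%N.
  move=> /FE /lt_m /andP[xv _] /FE /lt_m /andP[xw _]; move: xv xw; clear; lia.
have dy v w : v \in F -> w \in F -> (absz ((y v)%:Z - (y w)%:Z)%R <= m)%N.
  move=> /FE /lt_m /andP[_ yv] /FE /lt_m /andP[_ yw]; move: yv yw; clear; lia.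
(* Here [b * c] is a product of six coordinate differences, whence the range [m ^ 6] in the
   hypothesis on [tau]. *)
have bcm : (absz (b * c)%R <= m ^ 6)%N.
  rewrite /b /c Es Et !abszM [(m ^ 6)%N](_ : _ = (m * m * m) * (m * m * m))%N; last by ring.
  exact: leq_mul (leq_mul (leq_mul (dy _ _ F1 F0) (dy _ _ F2 F0)) (dx _ _ F2 F1))
                 (leq_mul (leq_mul (dx _ _ F1 F0) (dx _ _ F2 F0)) (dy _ _ F1 F2)).
(* A divisor may have either sign; recording the sign gives the factor 2 of the bound. *)
pose f v : bool * nat := (0 <= A * s v + c, absz (A * s v + c)).
have f_inj : {in F &, injective f}.
  move=> v w vF wF [E1 E2]; apply: chain_x_inj; rewrite ?FE //.
  have : A * s v + c = A * s w + c by move: E1 E2; move: (A * s v + c) (A * s w + c); clear; lia.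
  by move/addIr/(mulfI A0); rewrite /s => /addIr [].
have f_div v : v \in F -> (absz (A * s v + c)%R %| absz (b * c)%R)%N.
  move=> vF; rewrite -dvdzE; apply/dvdzP; exists (A * t v + b).
  transitivity (b * c + A * (A * (s v * t v) + b * s v + c * t v)); last by ring.
  by rewrite curve // mulr0 addr0.
have bc_gt0 : (0 < absz (b * c)%R)%N by rewrite absz_gt0.
have tB : (tau (absz (b * c)%R) <= B)%N by apply: tau_le; rewrite bc_gt0.
apply: leq_trans (leq_mul (leqnn 2) tB).
rewrite cardE -(size_map f) -[2%N]/(size [:: true; false]) -(size_allpairs pair).
apply: uniq_leq_size => [|_ /mapP[v vF ->]].
  by rewrite map_inj_in_uniq ?enum_uniq // => v w; rewrite !mem_enum; apply: f_inj.
rewrite mem_enum in vF; rewrite /f; apply: allpairs_f; last by rewrite -dvdn_divisors ?f_div.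
by rewrite !inE; case: (0 <= _).
Qed.

Hypothesis area_le : {in E, forall v, (12 * (x v * y v) ^ 2 <= m * Q ^ 5)%N}.

(** Points are classified by the binary logarithms of both coordinates and by [cell_label] for the
    corresponding dyadic box; each class satisfies the hypotheses of [cell_card]. *)
Theorem chain_card : (#|E| <= (trunc_log 2 m).+1 ^ 2 * (5 * Q).+1 * (2 * B))%N.
Proof.
set L := (trunc_log 2 m).+1.
pose X v := (2 ^ trunc_log 2 (x v))%N; pose Y v := (2 ^ trunc_log 2 (y v))%N.
have Xle v : v \in E ->
    (0 < X v <= x v)%N && (x v < 2 * X v)%N && (0 < Y v <= y v)%N && (y v < 2 * Y v)%N.
  move=> vE; have [x0 y0 _ _] := pos vE.
  have /andP[-> hx] := @trunc_log_bounds 2 (x v) isT x0.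
  have /andP[-> hy] := @trunc_log_bounds 2 (y v) isT y0.
  by rewrite !expn_gt0 /= -!expnS hx hy.
pose lab v : 'I_L * 'I_L * 'I_(5 * Q).+1 :=
  (inord (trunc_log 2 (x v)), inord (trunc_log 2 (y v)), inord (cell_label (X v) (Y v) v)).
have -> : ((trunc_log 2 m).+1 ^ 2 * (5 * Q).+1 * (2 * B) =
           \sum_(l : 'I_L * 'I_L * 'I_(5 * Q).+1) 2 * B)%N.
  by rewrite sum_nat_const !card_prod !card_ord.
rewrite -sum1_card (partition_big lab predT) //=; apply: leq_sum => l _.
rewrite sum1dep_card.
have [v0|none] := pickP (fun v => (v \in E) && (lab v == l)); last first.
  rewrite (_ : [set v | _] = finset.set0) ?cards0 //; apply/setP => v; rewrite !inE; exact: none.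
case/andP => v0E /eqP El.
have /andP[/andP[/andP[/andP[X0 Xx] xX] /andP[Y0 Yy]] yY] := Xle _ v0E.
have labE v w : v \in E -> w \in E -> lab v = lab w ->
    [/\ X v = X w, Y v = Y w & cell_label (X v) (Y v) v = cell_label (X w) (Y w) w].
  move=> vE wE [].
  have tl z : (z < m)%N -> (trunc_log 2 z < L)%N by move=> zm; rewrite ltnS leq_trunc_log // ltnW.
  have cl z : z \in E -> (cell_label (X z) (Y z) z < (5 * Q).+1)%N.
    move=> zE; have /andP[/andP[/andP[/andP[X0' _] xX'] _] _] := Xle _ zE.
    rewrite ltnS /cell_label.
    have : (x_cell (X z) z < 2 * Q)%N by rewrite ltn_divLR //; nia.
    by lia.
  have /andP[xv yv] := lt_m vE; have /andP[xw yw] := lt_m wE.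
  move=> /(congr1 val) /= + /(congr1 val) /= + /(congr1 val) /=.
  rewrite !inordK ?tl ?cl // => E1 E2 E3.
  by rewrite /X /Y E1 E2; split=> //; move: E3; rewrite /X /Y E1 E2.
apply: (@cell_card (X v0) (Y v0)) => //.
- by apply/fintype.subsetP => v; rewrite inE => /andP[].
- apply: leq_trans (area_le v0E); rewrite leq_mul2l; apply: leq_expn2r.
  exact: leq_mul.
move=> v w; rewrite !inE => /andP[vE /eqP Ev] /andP[wE /eqP Ew].
have [EX EY _] := labE _ _ vE v0E (etrans Ev (esym El)).
have [EX' EY' Ec] := labE _ _ wE v0E (etrans Ew (esym El)).
have [_ _ Evw] := labE _ _ vE wE (etrans Ev (esym Ew)).
rewrite EX EY EX' EY' in Evw.
have /andP[_ yv] := Xle _ vE; have /andP[_ yw] := Xle _ wE.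
by rewrite EY in yv; rewrite EY' in yw; apply: cell_label_inj.
Qed.

End Chain.

(** * Counting the points exposed towards the origin *)

Lemma Zp_unit_factor_gt0 (n : nat) (a x y : 'I_n.+2) : a \is a GRing.unit -> x * y = a -> (0 < x)%N.
Proof.
move=> ua E; rewrite lt0n; apply: contraTneq ua => x0.
by rewrite -E (_ : x = 0) ?mul0r ?unitr0 //; apply/val_inj.
Qed.

(** A point of the hyperbola in the box below [v] would have a value of the form no larger than at
    [v]. So [box_bound] applies to half the side lengths, and $v_1 \le 3 X$, $v_2 \le 2 Y$ give the
    factor $6^4$. *)
Lemma exposed_area (n : nat) (a : 'I_n.+2) (v : 'I_n.+2 * 'I_n.+2) (al be : nat) :
  a \is a GRing.unit -> v.1 * v.2 = a -> (0 < al)%N ->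
  (forall q : 'I_n.+2 * 'I_n.+2, q.1 * q.2 = a -> q != v ->
     (al * v.1 + be * v.2 < al * q.1 + be * q.2)%N) ->
  ((v.1 * v.2)%N ^ 4 <= 6 ^ 4 * 162 * tau n.+2 ^ 11 * n.+2 ^ 7)%N.
Proof.
move=> ua Ev al0 exp.
have v10 := Zp_unit_factor_gt0 ua Ev.
have v20 : (0 < v.2)%N by apply: (@Zp_unit_factor_gt0 _ a _ v.1) => //; rewrite mulrC.
have t0 : (0 < tau n.+2)%N by apply: tau_gt0.
have lx := ltn_ord v.1; have ly := ltn_ord v.2.
(* Rounding [X] down keeps [x1 + x2 + 1] strictly below [v.1], so that the points of the box differ
   from [v]; [Y] may be rounded up. *)
pose X := (v.1 %/ 2)%N; pose Y := (v.2.+1 %/ 2)%N.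
have hX : (2 * X <= v.1 <= 2 * X + 1)%N by rewrite /X; lia.
have hY : (2 * Y <= v.2 + 1)%N && (v.2 <= 2 * Y)%N by rewrite /Y; lia.
case/andP: hX => X1 X2; case/andP: hY => Y1 Y2.
have [X0|X0] := posnP X.
  have xy : (v.1 * v.2 <= n.+2)%N by rewrite -[leqRHS]mul1n leq_mul //; lia.
  apply: leq_trans (leq_expn2r 4 xy) _; rewrite -[leqLHS]mul1n.
  by apply: leq_mul; rewrite ?leq_pexp2l // muln_gt0 [X in _ && X]expn_gt0 t0.
have : ((X * Y) ^ 4 <= 162 * tau n.+2 ^ 11 * n.+2 ^ 7)%N.
  apply: (@box_bound n a) => //; [by lia | by lia |] => x1 x2 y1 y2; apply/eqP => Ea.
  have hx : (x1 + x2 + 1 < v.1)%N by move: (ltn_ord x1) (ltn_ord x2); lia.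
  have hy : (y1 + y2 + 1 <= v.2)%N by move: (ltn_ord y1) (ltn_ord y2); lia.
  have := exp ((x1 + x2 + 1)%:R, (y1 + y2 + 1)%:R) Ea.
  rewrite !Zp_natr_val !modn_small; [| by lia | by lia].
  have -> : ((x1 + x2 + 1)%:R, (y1 + y2 + 1)%:R) != v.
    apply/eqP => /(congr1 (fun z => val z.1)) /=; rewrite Zp_natr_val modn_small; lia.
  by move=> /(_ isT); rewrite ltnNge leq_add // leq_mul // ltnW.
move=> H; apply: (@leq_trans ((6 * (X * Y)) ^ 4)%N).
  apply: leq_expn2r; rewrite (_ : 6 * _ = (3 * X) * (2 * Y))%N; last by ring.
  by apply: leq_mul => //; lia.
rewrite expnMn; apply: leq_trans (leq_mul (leqnn _) H) _.
by rewrite !mulnA.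
Qed.

Lemma ceil_root10 (N : nat) : (0 < N)%N -> exists2 Q, (0 < Q)%N & (N <= Q ^ 10 <= 2 ^ 10 * N)%N.
Proof.
move=> N0; have exQ : exists Q, (N <= Q ^ 10)%N.
  by exists N; rewrite -{1}[N]expn1 leq_pexp2l.
case: (ex_minnP exQ) => Q NQ minQ; have Q0 : (0 < Q)%N by case: (Q) NQ => //; rewrite exp0n //; lia.
exists Q => //; rewrite NQ /=; case: Q Q0 {NQ} minQ => // [[|Q]] _ minQ.
  by rewrite exp1n; lia.
apply: (@leq_trans ((2 * Q.+1) ^ 10)%N); first by apply: leq_expn2r; lia.
rewrite expnMn leq_mul2l; apply/orP; right; rewrite leqNgt; apply/negP => /ltnW /minQ.
by rewrite ltnn.
Qed.

(** The count is $O(L^2 Q B)$ with $Q^{10}$ of order $\tau(m)^{11} m^5$. Raising to the power $10 k$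
    avoids roots: the divisor bound is used $20 + 11 + 10 = 41$ times and costs $m^{20 + 11 + 60} =
    m^{91}$. *)
Theorem exposed_card (k : nat) : exists C, forall (n : nat) (a : 'I_n.+2)
    (E : {set 'I_n.+2 * 'I_n.+2}) (al be : 'I_n.+2 * 'I_n.+2 -> nat),
  a \is a GRing.unit ->
  {in E, forall v, [/\ v.1 * v.2 = a, (0 < al v)%N & (0 < be v)%N]} ->
  {in E, forall v (q : 'I_n.+2 * 'I_n.+2), q.1 * q.2 = a -> q != v ->
     (al v * v.1 + be v * v.2 < al v * q.1 + be v * q.2)%N} ->
  (#|E| ^ (10 * k) <= C * n.+2 ^ (5 * k + 91))%N.
Proof.
have [C0 C0pos HC] := divisor_bound k.
(* The constants are kept abstract because [nat] numerals are unary. *)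
have [c1 c1pos Ec1] : exists2 c, (0 < c)%N & (c = 144 * (6 ^ 4 * 162))%N.
  by exists (144 * (6 ^ 4 * 162))%N; rewrite // muln_gt0 muln_gt0 expn_gt0.
have [d Ed] : exists d, d = 12%N by exists 12%N.
have [e Ee] : exists e, e = 2%N by exists 2%N.
pose c2 := (d ^ 10 * (e ^ 10 * c1))%N.
exists (c2 ^ k * C0 ^ 41)%N => n a E al be ua HE exp.
set m := n.+2.
have m0 : (0 < m)%N by [].
have t0 : (0 < tau m)%N by apply: tau_gt0.
(* Chosen so that $Q^{10} \ge N$ implies the square of [12 * P ^ 2 <= m * Q ^ 5] for every product
   [P] of coordinates allowed by [exposed_area]. *)
pose N := (c1 * tau m ^ 11 * m ^ 5)%N.
have [|Q Q0 /andP[NQ QN]] := @ceil_root10 N.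
  by rewrite /N muln_gt0 muln_gt0 c1pos !expn_gt0 t0.
have {}QN : (Q ^ 10 <= e ^ 10 * N)%N by rewrite Ee.
pose B := (\max_(i < (m ^ 6).+1) tau i)%N.
have tB i : (0 < i <= m ^ 6)%N -> (tau i <= B)%N.
  move=> /andP[_ le]; rewrite -ltnS in le.
  exact: (@leq_bigmax _ (fun i : 'I_(m ^ 6).+1 => tau i) (Ordinal le)).
have B0 : (0 < B)%N by apply: leq_trans (tB 1%N _); rewrite ?tau_gt0 // expn_gt0.
have BC : (B ^ k <= C0 * m ^ 6)%N.
  rewrite /B; have [|i ->] := @bigop.eq_bigmax _ (fun i : 'I_(m ^ 6).+1 => tau i).
    by rewrite card_ord.
  (* The maximum also ranges over the index 0, where [tau] takes the default value 1. *)
  have [->|i0] := posnP i.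
    by rewrite (_ : tau 0 = 1)%N // exp1n muln_gt0 C0pos expn_gt0.
  by apply: leq_trans (HC _ i0) _; rewrite leq_mul2l -ltnS ltn_ord orbT.
set L := (trunc_log 2 m).+1.
have LC : (L ^ k <= C0 * m)%N.
  (* A power $2^l$ has $l + 1$ divisors, so the divisor bound controls the logarithm as well. *)
  have L2 : (L <= tau (2 ^ trunc_log 2 m))%N.
    rewrite /L -[leqLHS](size_iota 0) -(size_map (expn 2)); apply: uniq_leq_size.
      by rewrite map_inj_uniq ?iota_uniq //; apply: expnI.
    move=> ? /mapP[i]; rewrite mem_iota /= add0n ltnS => he ->.
    by rewrite -dvdn_divisors ?expn_gt0 // dvdn_exp2l.
  apply: leq_trans (leq_expn2r k L2) _; apply: leq_trans (HC _ _) _; first by rewrite expn_gt0.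
  by rewrite leq_mul2l trunc_logP ?orbT.
have card : (#|E| <= L ^ 2 * (5 * Q).+1 * (2 * B))%N.
  apply: (@chain_card _ E (fun v => v.1) (fun v => v.2) al be) => //.
  - move=> v vE; have [Ev a0 b0] := HE _ vE; split=> //; first exact: Zp_unit_factor_gt0 Ev.
    by apply: (@Zp_unit_factor_gt0 _ a _ v.1) => //; rewrite mulrC.
  - move=> v w vE wE vw; apply: exp => //; last by rewrite eq_sym.
    by have [] := HE _ wE.
  - by move=> v _; rewrite !ltn_ord.
  - move=> v w vE wE; have [Ev _ _] := HE _ vE; have [Ew _ _] := HE _ wE.
    by have := congr1 val (etrans Ev (esym Ew)).
  move=> v vE; have [Ev a0 b0] := HE _ vE.
  have ar := exposed_area ua Ev a0 (exp _ vE).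
  move: ar; set P := (v.1 * v.2)%N => ar.
  rewrite -(@leq_exp2r _ _ 2) // (_ : (12 * P ^ 2) ^ 2 = 144 * P ^ 4)%N; last by ring.
  rewrite (_ : (m * Q ^ 5) ^ 2 = m ^ 2 * Q ^ 10)%N; last by ring.
  apply: (@leq_trans (c1 * (tau m ^ 11 * m ^ 7))%N).
    by rewrite Ec1 -mulnA leq_mul2l mulnA ar orbT.
  apply: leq_trans (leq_mul (leqnn (m ^ 2)) NQ); rewrite /N.
  rewrite (_ : m ^ 2 * _ = c1 * tau m ^ 11 * (m ^ 2 * m ^ 5))%N; last by ring.
  by rewrite -expnD !mulnA.
have card' : (#|E| <= d * (L ^ 2 * Q * B))%N.
  rewrite Ed.
  apply: leq_trans card _.
  apply: (@leq_trans (L ^ 2 * (6 * Q) * (2 * B))%N); last by apply/eq_leq; ring.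
  by rewrite leq_mul2r leq_mul2l; apply/orP; right; apply/orP; right; lia.
rewrite expnM.
apply: (@leq_trans (c2 ^ k * ((L ^ k) ^ 20 * ((tau m ^ k) ^ 11 * m ^ (5 * k) * (B ^ k) ^ 10)))%N).
  apply: (@leq_trans ((c2 * (L ^ 20 * (tau m ^ 11 * m ^ 5 * B ^ 10))) ^ k)%N).
    apply: leq_expn2r; apply: leq_trans (leq_expn2r 10 card') _.
    rewrite [leqRHS](_ : _ = d ^ 10 * (L ^ 20 * (e ^ 10 * N) * B ^ 10))%N; last first.
      by rewrite /c2 /N; ring.
    rewrite expnMn leq_mul2l; apply/orP; right.
    rewrite [leqLHS](_ : _ = L ^ 20 * Q ^ 10 * B ^ 10)%N; last by ring.
    exact: leq_mul (leq_mul (leqnn _) QN) (leqnn _).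
  rewrite expnMn leq_mul2l; apply/orP; right.
  rewrite expnMn; apply: leq_mul; first by rewrite -!expnM mulnC.
  rewrite expnMn; apply: leq_mul; last by rewrite -!expnM mulnC.
  by rewrite expnMn; apply: leq_mul; rewrite -!expnM mulnC.
have tC : (tau m ^ k <= C0 * m)%N by apply: HC.
rewrite -[leqRHS]mulnA leq_mul2l; apply/orP; right.
apply: leq_trans (leq_mul (leq_expn2r 20 LC)
  (leq_mul (leq_mul (leq_expn2r 11 tC) (leqnn _)) (leq_expn2r 10 BC))) _.
by rewrite expnD; move: (m ^ (5 * k))%N => M5; apply/eq_leq; ring.
Qed.

(** * Vertices of the hull *)

Definition cross (u v : int * int) : int := u.1 * v.2 - u.2 * v.1.

(** The origin is not in the convex hull of [s]: by Carathéodory's theorem, combinations of three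
    vectors suffice in the plane. Repetitions are allowed. *)
Definition positively_independent (s : seq (int * int)) : Prop :=
  forall w1 w2 w3 (c1 c2 c3 : int), w1 \in s -> w2 \in s -> w3 \in s ->
    0 < c1 -> 0 <= c2 -> 0 <= c3 ->
    c1 * w1.1 + c2 * w2.1 + c3 * w3.1 = 0 -> c1 * w1.2 + c2 * w2.2 + c3 * w3.2 = 0 -> False.

(** The sign [e] selects one of the two extreme rays of the cone spanned by [s]. If a new vector [w]
    lies beyond the old extreme [u] but some [v] lies beyond [w], then the identity $(u \times v) w
    + (v \times w) u + (w \times u) v = 0$ is a forbidden relation. *)
Lemma extremal_direction (e : int) (s : seq (int * int)) : s != [::] ->
  positively_independent s ->
  exists2 u, u \in s & forall w, w \in s -> 0 <= e * cross u w.
Proof.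
elim: s => // w s IH _ ind.
have crossxx u : cross u u = 0 by rewrite /cross; ring.
have [->|s0] := eqVneq s [::].
  by exists w => [|v]; rewrite inE // => /eqP ->; rewrite crossxx mulr0.
have [|u us Hu] := IH s0.
  by move=> w1 w2 w3 c1 c2 c3 h1 h2 h3; apply: ind; rewrite inE ?h1 ?h2 ?h3 orbT.
have [uw|uw] := leP 0 (e * cross u w).
  by exists u => [|v]; rewrite inE ?us ?orbT // => /orP[/eqP ->|/Hu].
exists w => [|v]; rewrite inE ?eqxx // => /orP[/eqP ->|vs]; first by rewrite crossxx mulr0.
rewrite leNgt; apply/negP => wv.
apply: (ind v u w (- (e * cross u w)) (- (e * cross w v)) (e * cross u v)).
- by rewrite inE vs orbT.
- by rewrite inE us orbT.
- by rewrite inE eqxx.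
- by rewrite oppr_gt0.
- by rewrite oppr_ge0 ltW.
- exact: Hu.
- by rewrite /cross; ring.
- by rewrite /cross; ring.
Qed.

(** A planar case of Gordan's theorem. If the extreme rays [u], [v] are not parallel, the form $w
    \mapsto u \times w + w \times v$ is positive. *)
Lemma positive_functional (s : seq (int * int)) : positively_independent s ->
  exists f : int * int, forall w, w \in s -> 0 < f.1 * w.1 + f.2 * w.2.
Proof.
move=> ind; have [->|s0] := eqVneq s [::]; first by exists (0, 0).
have [u us Hu] := extremal_direction 1 s0 ind.
have [v vs Hv] := extremal_direction (-1) s0 ind.
have {}Hu w : w \in s -> 0 <= cross u w by move/Hu; rewrite mul1r.
have {}Hv w : w \in s -> 0 <= cross w v.
  by move/Hv; rewrite (_ : -1 * cross v w = cross w v) // /cross; ring.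
have [uv|] := ltP 0 (cross u v).
  exists (v.2 - u.2, u.1 - v.1) => w ws /=.
  have -> : (v.2 - u.2) * w.1 + (u.1 - v.1) * w.2 = cross u w + cross w v by rewrite /cross; ring.
  rewrite lt_def addr_ge0 ?Hu ?Hv // andbT paddr_eq0 ?Hu ?Hv //.
  apply/negP => /andP[/eqP E1 /eqP E2].
  apply: (ind w w w (cross u v) 0 0) => //; rewrite !mul0r !addr0.
    transitivity (cross w v * u.1 + cross u w * v.1); last by rewrite E1 E2 !mul0r.
    by rewrite /cross; ring.
  transitivity (cross w v * u.2 + cross u w * v.2); last by rewrite E1 E2 !mul0r.
  by rewrite /cross; ring.
(* In the remaining case all vectors lie on the ray of [u], and the inner product with [u] is
   positive. *)
move=> uv0; have {}uv0 : cross u v = 0 by apply/eqP; rewrite eq_le uv0 Hu.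
exists u => w ws; rewrite ltNge; apply/negP => dot.
have E1 : cross u w = 0.
  apply/eqP; rewrite eq_le Hu // andbT leNgt; apply/negP => uw.
  apply: (ind v u u (cross u w) (cross w v) 0) => //; first exact: Hv.
    transitivity (cross u v * w.1); last by rewrite uv0 mul0r.
    by rewrite /cross; ring.
  transitivity (cross u v * w.2); last by rewrite uv0 mul0r.
  by rewrite /cross; ring.
have uu : 0 <= u.1 * u.1 + u.2 * u.2 by rewrite addr_ge0 // -expr2 sqr_ge0.
have u0 : 0 < u.1 * u.1 + u.2 * u.2.
  rewrite lt_def uu andbT -!expr2 paddr_eq0 ?sqr_ge0 // !sqrf_eq0.
  apply/negP => /andP[/eqP z1 /eqP z2].
  by apply: (ind u u u 1 0 0) => //; rewrite ?z1 ?z2 !mulr0.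
apply: (ind w u u (u.1 * u.1 + u.2 * u.2) (- (u.1 * w.1 + u.2 * w.2)) 0) => //.
- by rewrite oppr_ge0.
- transitivity (- (cross u w) * u.2); last by rewrite E1 oppr0 mul0r.
  by rewrite /cross; ring.
- transitivity (cross u w * u.1); last by rewrite E1 mul0r.
  by rewrite /cross; ring.
Qed.

Lemma convex_hull_conv (R : realType) (M : lmodType R) (A : set M) (x y : M) (t : R) :
  0 <= t -> t <= 1 -> convex_hull A x -> convex_hull A y -> convex_hull A (t *: x + (1 - t) *: y).
Proof.
move=> t0 t1 Kx Ky C [cC AC].
have := cC x y (Itv01 t0 t1) (mem_set (Kx C (conj cC AC))) (mem_set (Ky C (conj cC AC))).
by move/set_mem.
Qed.

(** A vanishing combination would put [p] strictly between [q1] and the barycentre [z] of [q2] and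
    [q3], contradicting extremality. *)
Lemma extreme_point_combination (R : realType) (M : lmodType R) (A : set M) (p q1 q2 q3 : M)
  (c1 c2 c3 : R) : extreme_points (convex_hull A) p -> A q1 -> A q2 -> A q3 -> q1 != p ->
  0 < c1 -> 0 <= c2 -> 0 <= c3 -> c1 *: (q1 - p) + c2 *: (q2 - p) + c3 *: (q3 - p) != 0.
Proof.
move=> [Kp ext] A1 A2 A3 q1p c10 c20 c30; apply/eqP => E.
have sub : (A `<=` convex_hull A)%classic by exact: sub_smallest.
have [c0|c0] := eqVneq (c2 + c3) 0.
  move/eqP: c0; rewrite paddr_eq0 // => /andP[/eqP c2z /eqP c3z].
  move: E; rewrite c2z c3z !scale0r !addr0 => /eqP.
  by rewrite scaler_eq0 subr_eq0 (negPf q1p) orbF gt_eqF.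
have c23 : 0 < c2 + c3 by rewrite lt_def c0 addr_ge0.
pose z := (c2 / (c2 + c3)) *: q2 + (1 - c2 / (c2 + c3)) *: q3.
have Kz : convex_hull A z.
  apply: convex_hull_conv; [|  | exact: sub | exact: sub].
    by rewrite divr_ge0 // ltW.
  by rewrite ler_pdivrMr // mul1r lerDl.
have c123 : 0 < c1 + (c2 + c3) by rewrite addr_gt0.
have [||e1 _] := ext q1 z (c1 / (c1 + (c2 + c3))) (sub _ A1) Kz.
- by rewrite divr_gt0 //= ltr_pdivrMr // mul1r ltrDl.
- have {E} : c1 *: q1 + c2 *: q2 + c3 *: q3 = (c1 + (c2 + c3)) *: p.
    apply/eqP; rewrite -subr_eq0 -[X in _ == X]E; apply/eqP.
    have regroup (a b c a' b' c' : M) : a + b + c - (a' + (b' + c')) = a - a' + (b - b') + (c - c').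
      by rewrite !opprD [a - a' + _]addrACA [RHS]addrACA !addrA.
    by rewrite !scalerBr !scalerDl regroup.
  move=> E; apply: (scalerI (lt0r_neq0 c123)); rewrite -E scalerDr !scalerA.
  rewrite mulrC divfK ?lt0r_neq0 // -addrA; congr (_ + _).
  rewrite mulrBr mulr1 mulrC divfK ?lt0r_neq0 // [c1 + _]addrC addrK.
  rewrite /z scalerDr !scalerA mulrC divfK // mulrBr mulr1.
  by rewrite [_ * (c2 / _)]mulrC divfK // [c2 + c3]addrC addrK.
by move: q1p; rewrite e1 eqxx.
Qed.

Lemma plane_point_inj (R : realType) : injective (@plane_point R).
Proof. by move=> [x y] [x' y'] [] /intr_inj -> /intr_inj ->. Qed.

Lemma exposed_vertex (R : realType) (a : int) (m : nat) (p : int * int) :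
  modular_hyperbola a m p -> extreme_points (@hyperbola_hull R a m) (plane_point R p) ->
  exists f : int * int, [/\ f.1 != 0, f.2 != 0 &
    forall q, modular_hyperbola a m q -> q != p -> 0 < f.1 * (q.1 - p.1) + f.2 * (q.2 - p.2)].
Proof.
move=> Hp ext; pose H := modular_hyperbola a m.
have finH : finite_set H by exact: finite_modular_hyperbola.
pose s := [seq (q.1 - p.1, q.2 - p.2) | q <- [seq q <- fset_set H | q != p]].
have memH q : (q \in (fset_set H : seq _)) -> H q.
  by rewrite (in_fset_set finH) => /set_mem.
have ind : positively_independent s.
  move=> _ _ _ c1 c2 c3 /mapP[q1 + ->] /mapP[q2 + ->] /mapP[q3 + ->] c10 c20 c30 /= E1 E2.
  rewrite !mem_filter => /andP[q1p /memH h1] /andP[q2p /memH h2] /andP[q3p /memH h3].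
  have := @extreme_point_combination R _ _ _ (plane_point R q1) (plane_point R q2)
    (plane_point R q3) c1%:~R c2%:~R c3%:~R ext.
  rewrite ltr0z !ler0z c10 c20 c30 (inj_eq (@plane_point_inj R)) => /(_ _ _ _ q1p isT isT isT).
  move/(_ (ex_intro2 _ _ _ h1 erefl) (ex_intro2 _ _ _ h2 erefl) (ex_intro2 _ _ _ h3 erefl)).
  move/eqP; apply; rewrite [LHS]surjective_pairing; congr pair => /=.
    rewrite -[RHS](_ : (0 : int)%:~R = 0) // -E1.
    by rewrite !intrD !intrM !intrB.
  rewrite -[RHS](_ : (0 : int)%:~R = 0) // -E2.
  by rewrite !intrD !intrM !intrB.
have [f Hf] := positive_functional ind.
(* Both coefficients become odd, hence nonzero. The perturbation changes the value by less than
   [2 * m], while the scaled form is at least [2 * m] because [f] takes integer values. *)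
exists (2 * m%:Z * f.1 + 1, 2 * m%:Z * f.2 + 1); split => /=; [by lia | by lia |].
move=> q Hq qp.
have : 0 < f.1 * (q.1 - p.1) + f.2 * (q.2 - p.2).
  apply: (Hf (q.1 - p.1, q.2 - p.2)); apply/mapP; exists q => //.
  by rewrite mem_filter qp /= (in_fset_set finH); apply: mem_set.
case: Hp Hq => [_ /andP[p1 p1'] /andP[p2 p2']] [_ /andP[q1 q1'] /andP[q2 q2']] pos.
have : 2 * m%:Z <= 2 * m%:Z * (f.1 * (q.1 - p.1) + f.2 * (q.2 - p.2)).
  by rewrite ler_peMr //; lia.
rewrite (_ : (2 * m%:Z * f.1 + 1) * _ + _ = 2 * m%:Z * (f.1 * (q.1 - p.1) + f.2 * (q.2 - p.2))
   + ((q.1 - p.1) + (q.2 - p.2))); last by ring.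
by move: (_ * _ * (_ + _)) => z; lia.
Qed.

(** * Residues, and the reflections of the square *)

Lemma Zp_intr_eq0 (n : nat) (z : int) : (z%:~R == 0 :> 'I_n.+2) = (n.+2 %| z)%Z.
Proof.
have nat_case k : (k%:R == 0 :> 'I_n.+2) = (n.+2 %| k)%N by rewrite -val_eqE /= Zp_natr_val.
case: z => k; first by rewrite -pmulrn nat_case.
by rewrite NegzE mulrNz oppr_eq0 -pmulrn nat_case dvdzE abszN.
Qed.

Lemma Zp_intr_eq (n : nat) (y z : int) :
  (y%:~R == z%:~R :> 'I_n.+2) = (y == z %[mod n.+2])%Z.
Proof. by rewrite -subr_eq0 -intrB Zp_intr_eq0 eqz_mod_dvd. Qed.

Lemma Zp_intr_val (n : nat) (x : 'I_n.+2) : (x%:Z)%:~R = x.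
Proof. by rewrite -pmulrn; apply/val_inj; rewrite /= Zp_natr_val modn_small. Qed.

Lemma Zp_intr_unit (n : nat) (a : int) : gcdz a n.+2 = 1 -> (a%:~R : 'I_n.+2) \is a GRing.unit.
Proof.
move=> co; have [u [v]] := Bezoutz a n.+2; rewrite co => E.
have ua : (u%:~R : 'I_n.+2) * a%:~R = 1.
  rewrite -intrM -[RHS]/(1%:~R); apply/eqP; rewrite Zp_intr_eq eqz_mod_dvd -E.
  by rewrite opprD addNKr rpredN dvdz_mull.
by apply/unitrP; exists u%:~R; rewrite [a%:~R * _]mulrC ua.
Qed.

Definition lower_left_exposed (n : nat) (a : 'I_n.+2) (v : 'I_n.+2 * 'I_n.+2) : Prop :=
  v.1 * v.2 = a /\ exists al be : nat, [/\ (0 < al)%N, (0 < be)%N &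
    forall q : 'I_n.+2 * 'I_n.+2, q.1 * q.2 = a -> q != v ->
      (al * v.1 + be * v.2 < al * q.1 + be * q.2)%N].

Lemma lower_left_exposed_card (k : nat) : exists C, forall (n : nat) (a : 'I_n.+2),
  a \is a GRing.unit ->
  (#|[set v | `[< lower_left_exposed a v >]]%SET| ^ (10 * k) <= C * n.+2 ^ (5 * k + 91))%N.
Proof.
have [C HC] := exposed_card k; exists C => n a ua.
pose P (v : 'I_n.+2 * 'I_n.+2) (f : nat * nat) := lower_left_exposed a v ->
  [/\ (0 < f.1)%N, (0 < f.2)%N & forall q : 'I_n.+2 * 'I_n.+2, q.1 * q.2 = a -> q != v ->
      (f.1 * v.1 + f.2 * v.2 < f.1 * q.1 + f.2 * q.2)%N].
have /boolp.choice[f Hf] : forall v, exists f, P v f.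
  move=> v; have [[Ev [al [be H]]]|nv] := pselect (lower_left_exposed a v).
    by exists (al, be).
  by exists (0, 0)%N => /nv.
apply: (HC n a _ (fun v => (f v).1) (fun v => (f v).2)) => // v; rewrite inE => /asboolP ev.
  by have [] := Hf _ ev; split=> //; case: ev.
by have [] := Hf _ ev.
Qed.

Definition signed (V : zmodType) (s : bool) (x : V) : V := if s then - x else x.

Lemma signedK (V : zmodType) (s : bool) : involutive (@signed V s).
Proof. by case: s => x //=; rewrite /signed opprK. Qed.

Lemma signedM (V : pzRingType) (s t : bool) (x y : V) :
  signed s x * signed t y = signed (s (+) t) (x * y).
Proof. by case: s; case: t; rewrite /signed /= ?mulrNN ?mulNr ?mulrN. Qed.

Lemma signed_unit (V : unitRingType) (s : bool) (x : V) :
  x \is a GRing.unit -> signed s x \is a GRing.unit.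
Proof. by case: s; rewrite /signed ?unitrN. Qed.

(* Negation in the ring of residues is the reflection [x |-> m - x]. *)
Lemma val_signed (n : nat) (s : bool) (x : 'I_n.+2) : (0 < x)%N ->
  (signed s x : nat)%:Z = if s then (n.+2)%:Z - (x : nat)%:Z else (x : nat)%:Z.
Proof.
case: s => // x0; rewrite /signed /= modn_small; last by rewrite ltn_subrL x0.
by move: (ltn_ord x); lia.
Qed.

Lemma hyperbola_point (n : nat) (a : int) (v : 'I_n.+2 * 'I_n.+2) : gcdz a n.+2 = 1 ->
  modular_hyperbola a n.+2 ((v.1 : nat)%:Z, (v.2 : nat)%:Z) <-> v.1 * v.2 = a%:~R.
Proof.
move=> co; have Ev : (((v.1 : nat)%:Z * (v.2 : nat)%:Z)%:~R : 'I_n.+2) = v.1 * v.2.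
  by rewrite intrM !Zp_intr_val.
split=> [[E _ _]|E]; first by rewrite -Ev; apply/eqP; rewrite Zp_intr_eq; apply/eqP.
have ua := Zp_intr_unit co.
have v1 := Zp_unit_factor_gt0 ua E.
have v2 : (0 < v.2)%N by apply: (@Zp_unit_factor_gt0 _ _ _ v.1 ua); rewrite mulrC.
have := ltn_ord v.1; have := ltn_ord v.2.
by split=> /=; [apply/eqP; rewrite -Zp_intr_eq Ev E | lia | lia].
Qed.

(** The signs of the coefficients of a form minimal at the vertex choose the reflection that makes
    both positive. It carries the hyperbola of [a] to that of [a] or [- a]. *)
Lemma vertex_exposed (R : realType) (n : nat) (a : int) (v : 'I_n.+2 * 'I_n.+2) :
  gcdz a n.+2 = 1 ->
  extreme_points (@hyperbola_hull R a n.+2) (plane_point R ((v.1 : nat)%:Z, (v.2 : nat)%:Z)) ->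
  exists s : bool * bool,
    lower_left_exposed (signed (s.1 (+) s.2) a%:~R) (signed s.1 v.1, signed s.2 v.2).
Proof.
move=> co ext; have ua := Zp_intr_unit co.
have Hv : modular_hyperbola a n.+2 ((v.1 : nat)%:Z, (v.2 : nat)%:Z).
  by have [p Hp /plane_point_inj <-] := extreme_points_hull ext.
have pos2 (w : 'I_n.+2 * 'I_n.+2) : w.1 * w.2 = a%:~R -> (0 < w.1)%N /\ (0 < w.2)%N.
  move=> E; split; first exact: Zp_unit_factor_gt0 E.
  by apply: (@Zp_unit_factor_gt0 _ _ _ w.1 ua); rewrite mulrC.
have [f [f1 f2 Hf]] := exposed_vertex Hv ext.
have Ev := (hyperbola_point v co).1 Hv.
exists (f.1 < 0, f.2 < 0); split; first by rewrite /= signedM Ev.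
exists (absz f.1), (absz f.2); split; rewrite ?absz_gt0 //= => q Eq nq.
pose w := (signed (f.1 < 0) q.1, signed (f.2 < 0) q.2).
have Ew : w.1 * w.2 = a%:~R by rewrite /= signedM Eq signedK.
have Eq1 : q.1 = signed (f.1 < 0) w.1 by rewrite /= signedK.
have Eq2 : q.2 = signed (f.2 < 0) w.2 by rewrite /= signedK.
have wv : w != v.
  by apply: contraNneq nq => E; rewrite [q]surjective_pairing Eq1 Eq2 E.
clearbody w; have [w10 w20] := pos2 _ Ew; have [v10 v20] := pos2 _ Ev.
have := Hf ((w.1 : nat)%:Z, (w.2 : nat)%:Z) ((hyperbola_point w co).2 Ew).
rewrite Eq1 Eq2 -ltz_nat !PoszD !PoszM !val_signed //.
move: w10 w20 v10 v20 wv; clear; case: w => w1 w2; case: v => v1 v2 /= _ _ _ _ wv H.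
have {H} : 0 < f.1 * ((w1 : nat)%:Z - (v1 : nat)%:Z) + f.2 * ((w2 : nat)%:Z - (v2 : nat)%:Z).
  by apply: H; apply: contraNneq wv => -[/val_inj -> /val_inj ->].
by case: (ltP f.1 0) => h1; case: (ltP f.2 0) => h2;
  rewrite ?(ltz0_abs h1) ?(gez0_abs h1) ?(ltz0_abs h2) ?(gez0_abs h2); lia.
Qed.

Lemma num_vertices_le (R : realType) (n : nat) (a : int) : gcdz a n.+2 = 1 ->
  (num_vertices R a n.+2 <= \sum_(s : bool * bool)
     #|[set v | `[< lower_left_exposed (signed (s.1 (+) s.2) (a%:~R : 'I_n.+2)) v >]]%SET|)%N.
Proof.
move=> co; set S := extreme_points (@hyperbola_hull R a n.+2).
pose pt (v : 'I_n.+2 * 'I_n.+2) := plane_point R ((v.1 : nat)%:Z, (v.2 : nat)%:Z).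
pose V := [set v | `[< S (pt v) >]]%SET.
have finS : finite_set S by exact: finite_hyperbola_vertices.
apply: (@leq_trans #|V|).
  have sub : (fset_set S `<=` [fset pt v | v in enum V])%fset.
    apply/fsubsetP => z; rewrite (in_fset_set finS) => /set_mem Sz.
    have [p Hp Ez] := extreme_points_hull Sz.
    have [v Ep] : exists v : 'I_n.+2 * 'I_n.+2, p = ((v.1 : nat)%:Z, (v.2 : nat)%:Z).
      case: p Hp {Ez} => [x y] [_ /= /andP[x1 x2] /andP[y1 y2]].
      exists (inord (absz x), inord (absz y)) => /=; rewrite !inordK; [|lia|lia].
      by congr pair; lia.
    apply/imfsetP; exists v; last by rewrite -Ez Ep.
    by rewrite /= mem_enum inE; apply/asboolP; rewrite /pt -Ep Ez.
  apply: leq_trans (fsubset_leq_card sub) _; apply: leq_trans (leq_imfset_card _ _ _) _.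
  by rewrite cardE; apply: size_undup.
pose r (s : bool * bool) (v : 'I_n.+2 * 'I_n.+2) := (signed s.1 v.1, signed s.2 v.2).
have rK s : involutive (r s) by case=> v1 v2; rewrite /r /= !signedK.
pose E (s : bool * bool) :=
  [set v | `[< lower_left_exposed (signed (s.1 (+) s.2) (a%:~R : 'I_n.+2)) v >]]%SET.
apply: (@leq_trans #|(\bigcup_(s : bool * bool) (r s @^-1: E s))%SET|).
  apply/subset_leq_card/fintype.subsetP => v; rewrite inE => /asboolP /(vertex_exposed co)[s Hs].
  by apply/finset.bigcupP; exists s => //; rewrite !finset.inE; apply/asboolP.
elim/big_rec2: _ => [|s N B _ le]; first by rewrite cards0.
apply: leq_trans (leq_card_setU _ _).1 _; rewrite leq_add // card_preimset //.
exact: inv_inj (rK s).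
Qed.

Lemma num_vertices_bound (k : nat) : exists C, forall (R : realType) (n : nat) (a : int),
  gcdz a n.+2 = 1 -> (num_vertices R a n.+2 ^ (10 * k) <= C * n.+2 ^ (5 * k + 91))%N.
Proof.
have [C HC] := lower_left_exposed_card k.
exists (4 ^ (10 * k) * C)%N => R n a co.
pose F (s : bool * bool) :=
  #|[set v | `[< lower_left_exposed (signed (s.1 (+) s.2) (a%:~R : 'I_n.+2)) v >]]%SET|.
have [s Es] : {s | \max_s F s = F s}%N by apply: bigop.eq_bigmax; rewrite card_prod card_bool.
have le4 : (num_vertices R a n.+2 <= 4 * F s)%N.
  apply: leq_trans (num_vertices_le R co) _.
  apply: (@leq_trans (\sum_(t : bool * bool) F s)%N); last first.
    by rewrite sum_nat_const card_prod card_bool.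
  by apply: leq_sum => t _; rewrite -Es; apply: (@leq_bigmax _ F t).
apply: leq_trans (leq_expn2r _ le4) _; rewrite expnMn -mulnA leq_mul2l; apply/orP; right.
by apply/HC/signed_unit/Zp_intr_unit.
Qed.

Theorem theorem1 (R : realType) (eps : R) (heps : 0 < eps) :
  exists m0 : nat, forall m : nat, (m0 <= m)%N ->
  forall a : int, gcdz a m%:Z = 1 ->
  (num_vertices R a m)%:R <= m%:R `^ (2^-1 + eps).
Proof.
(* After raising to the power $10 k$ the goal has exponent $5 k + 10 k \varepsilon$, against $5 k +
   91$ from the count and 1 more to absorb the constant: $10 k \varepsilon \ge 92$ suffices. *)
pose k := (Num.bound (92 / (10 * eps))).+1.
have hk : 92 <= (10 * k)%:R * eps.
  have : 92 / (10 * eps) < k%:R.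
    apply: lt_trans (archi_boundP _) _; last by rewrite ltr_nat.
    by rewrite divr_ge0 // mulr_ge0 // ltW.
  rewrite ltr_pdivrMr ?mulr_gt0 // => /ltW H; apply: le_trans H _.
  by rewrite natrM mulrA [k%:R * 10]mulrC.
have [C HC] := num_vertices_bound k.
(* From [C] on, the modulus itself dominates the constant; the bound 2 gives it the form [n.+2]. *)
exists (maxn C 2) => [[|[|n]]]; rewrite ?geq_max ?andbF // => /andP[Cm _] a co.
have m1 : 1 <= n.+2%:R :> R by rewrite ler1n.
rewrite -(@ler_pXn2r _ (10 * k)) ?nnegrE ?powR_ge0 //.
rewrite -natrX -powR_mulrn ?powR_ge0 // -powRrM.
apply: (@le_trans _ _ (n.+2 ^ (5 * k + 92))%N%:R).
  rewrite ler_nat; apply: leq_trans (HC R n a co) _.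
  rewrite [leqRHS](_ : _ = n.+2 * n.+2 ^ (5 * k + 91))%N; last by rewrite -expnS -addnS.
  by rewrite leq_mul2r Cm orbT.
rewrite natrX -powR_mulrn // ler_powR // mulrDl natrD lerD //.
  by rewrite !natrM mulrA -[10]/((2 * 5)%N%:R) natrM mulrA mulVf ?mul1r // pnatr_eq0.
by rewrite mulrC.
Qed.
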